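(* Let $r\ge 0$, $s\geq 1$ be integers and let $N_{r,s}$ be a pseudo $H$-type Lie group, where $(r,s)$ is the signature of the left-invariant pseudo-Riemannian metric restricted to the centre. Let $\mathfrak{n}_{r,s}=\mathfrak{z}\oplus\mathfrak{v}$ be the Lie algebra of $N_{r,s}$, where $\mathfrak z$ is the centre and $\mathfrak v$ is a minimal admissible module for the Clifford algebra $\operatorname{Cl}(\mathbb R^{r,s})$. Then the following three assertions hold: 1) $N_{r,s}$ is naturally reductive (hence, geodesic orbit) if and only if $(r,s)\in\{(0,1),(1,2)\}$; 2) $N_{r,s}$ is geodesic orbit but not naturally reductive if and only if $(r,s)=(3,4)$; 3) $N_{r,s}$ with $(r,s)\notin\{(0,1),(1,2),(3,4)\}$ is not a geodesic orbit pseudo-Riemannian manifold.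
   Context: A scalar product is a non-degenerate symmetric bilinear form. $\mathbb R^{r,s}$ is $\mathbb R^{r+s}$ with $\langle Z,W\rangle_{r,s}=\sum_{i=1}^r z_iw_i-\sum_{j=1}^s z_{r+j}w_{r+j}$. Admissible module: a representation $J\colon \operatorname{Cl}(\mathbb R^{r,s})\to\operatorname{End}(\mathfrak v)$ on a finite-dimensional real vector space (so $J_Z^2=-\langle Z,Z\rangle_{r,s}\operatorname{Id}$ for $Z\in\mathbb R^{r,s}$) together with a scalar product $\langle\cdot,\cdot\rangle_{\mathfrak v}$ on $\mathfrak v$ such that every $J_Z$, $Z\in\mathbb R^{r,s}$, is skew-symmetric: $\langle J_ZX,Y\rangle_{\mathfrak v}=-\langle X,J_ZY\rangle_{\mathfrak v}$. It is minimal admissible if $\dim\mathfrak v$ is the smallest possible among non-zero admissible modules of $\operatorname{Cl}(\mathbb R^{r,s})$. Pseudo $H$-type Lie algebra: $\mathfrak n_{r,s}=\mathfrak z\oplus\mathfrak v$ (orthogonal sum of $\mathfrak z=\mathbb R^{r,s}$ and an admissible module $\mathfrak v$), with $\mathfrak z$ central and $[\cdot,\cdot]\colon\mathfrak v\times\mathfrak v\to\mathfrak z$ defined by $\langle J_Z(X),Y\rangle_{\mathfrak v}=\langle[X,Y],Z\rangle_{r,s}$. $N_{r,s}$ is the connected simply connected Lie group with Lie algebra $\mathfrak n_{r,s}$, endowed with the left-invariant pseudo-Riemannian metric determined by the scalar product $\langle\cdot,\cdot\rangle=\langle\cdot,\cdot\rangle_{r,s}+\langle\cdot,\cdot\rangle_{\mathfrak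 v}$. Isometries: the isometry group used is $G=N_{r,s}\rtimes H$, where $H=\{(\varphi,\psi)\in O(\mathfrak z)\times O(\mathfrak v)\mid \psi J_Z\psi^{-1}=J_{\varphi(Z)}\ \forall Z\in\mathfrak z\}$ is the group of isometric automorphisms, with Lie algebra $\mathfrak h=\{D=(C,A)\in\mathfrak{so}(\mathfrak z)\times\mathfrak{so}(\mathfrak v)\mid [A,J_Z]=J_{C(Z)}\ \forall Z\in\mathfrak z\}$ (the paper identifies the connected isometry group of $N_{r,s}$ with this group). Thus $N_{r,s}=G/H$. Geodesic orbit: a reductive homogeneous pseudo-Riemannian manifold $G/H$ is geodesic orbit if the geodesic through $eH$ with any initial vector is (up to reparametrization) an orbit of a one-parameter subgroup of $G$. For $N_{r,s}$ this is equivalent to: for all $Z\in\mathfrak z$, $X\in\mathfrak v$ there are $D=(C,A)\in\mathfrak h$ and $k\in\mathbb R$ such that $(C+k\operatorname{Id})Z=0$ and $(A+k\operatorname{Id})X=J_Z(X)$. Naturally reductive: there is a reductive decomposition $\mathfrak g=\mathfrak h\oplus\mathfrak m$ of the Lie algebra of $G$ with $\langle[T,Q]_{\mathfrak m},R\rangle=-\langle Q,[T,R]_{\mathfrak m}\rangle$ for all $T,Q,R\in\mathfrak m$, where $\langle\cdot,\cdot\rangle$ is the scalar product on $\mathfrak m$ induced by the metric and the subscript denotes the $\mathfrak m$-component. *)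

(* Defs.v *)
From HB Require Import structures.
From mathcomp Require Import all_boot all_order all_algebra.
From mathcomp Require Import all_classical all_reals all_analysis.

Set Implicit Arguments.
Unset Strict Implicit.
Unset Printing Implicit Defensive.

Import Order.TTheory GRing.Theory Num.Theory.
Import numFieldNormedType.Exports.

Local Open Scope classical_set_scope.
Local Open Scope ring_scope.

Section Calculus.
Variable R : realType.

(* Calculus of curves in R^n and in matrix spaces is done entrywise, so that
   only derivatives of functions R -> R are involved. *)
Definition smooth_on (D : set R) m n (f : R -> 'M[R]_(m, n)) : Prop :=
  forall i j k t, D t -> derivable (derive1n k (fun u => f u i j)) t 1.

Definition velocity m n (f : R -> 'M[R]_(m, n)) (t : R) : 'M[R]_(m, n) :=
  \matrix_(i, j) derive1 (fun u => f u i j) t.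

(* Smooth with nowhere vanishing derivative on the whole line, hence a
   diffeomorphism of R onto the open interval [range phi]. *)
Definition line_diffeo (phi : R -> R) : Prop :=
  (forall k t, derivable (derive1n k phi) t 1) /\
  (forall t, derive1 phi t != 0).

Definition directional n (f : 'cV[R]_n -> R) (p u : 'cV[R]_n) : R :=
  derive1 (fun t : R => f (p + t *: u)) 0.

(* A metric on R^n: [g p u v] is the scalar product of the tangent vectors
   [u] and [v] at the point [p]. *)
Definition metric n := 'cV[R]_n -> 'cV[R]_n -> 'cV[R]_n -> R.

(* Christoffel symbols of the first kind of the Levi-Civita connection:
   [christoffel g p u v w] = g_p (Gamma_p (u, v), w). *)
Definition christoffel n (g : metric n) (p u v w : 'cV[R]_n) : R :=
  2^-1 * (directional (fun q => g q v w) p u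
          + directional (fun q => g q u w) p v
          - directional (fun q => g q u v) p w).

(* The equation nabla_(c') c' = 0 in the global chart R^n, with the index
   lowered by the non-degenerate metric [g]. *)
Definition geodesic_on n (g : metric n) (D : set R) (c : R -> 'cV[R]_n) : Prop :=
  smooth_on D c /\
  forall t, D t -> forall w,
    g (c t) (velocity (velocity c) t) w
    + christoffel g (c t) (velocity c t) (velocity c t) w = 0.

End Calculus.

Section Forms.
Variable R : realType.

Record scalar_product n (b : 'cV[R]_n -> 'cV[R]_n -> R) : Prop := ScalarProduct {
  sp_sym : forall x y, b x y = b y x;
  sp_linear : forall a x y z, b (a *: x + y) z = a * b x z + b y z;
  sp_nondeg : forall x, (forall y, b x y = 0) -> x = 0 }.

Definition orthogonal_mx n (b : 'cV[R]_n -> 'cV[R]_n -> R) (M : 'M[R]_n) : Prop :=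
  forall x y, b (M *m x) (M *m y) = b x y.

Definition skew_mx n (b : 'cV[R]_n -> 'cV[R]_n -> R) (M : 'M[R]_n) : Prop :=
  forall x y, b (M *m x) y = - b x (M *m y).

Definition sp_rs (r s : nat) (Z W : 'cV[R]_(r + s)) : R :=
  \sum_(i < r) Z (lshift s i) 0 * W (lshift s i) 0
  - \sum_(j < s) Z (rshift r j) 0 * W (rshift r j) 0.

End Forms.

(* By the universal property, representations of the Clifford algebra
   Cl(R^{r,s}) on R^d are the linear maps Z |-> J_Z into 'M_d such that
   J_Z^2 = - <Z, Z> Id. *)
Record admissible_module (R : realType) (r s : nat) := AdmissibleModule {
  dimv : nat;
  J : {linear 'cV[R]_(r + s) -> 'M[R]_dimv};
  formv : 'cV[R]_dimv -> 'cV[R]_dimv -> R;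
  formv_sp : scalar_product formv;
  J_clifford : forall Z, J Z *m J Z = (- sp_rs Z Z)%:M;
  J_skew : forall Z, skew_mx formv (J Z) }.

Definition minimal_admissible (R : realType) (r s : nat)
    (M : admissible_module R r s) : Prop :=
  (0 < dimv M)%N /\
  forall M' : admissible_module R r s, (0 < dimv M')%N -> (dimv M <= dimv M')%N.

Section PseudoHType.
Variables (R : realType) (r s : nat) (M : admissible_module R r s).

Local Notation z := 'cV[R]_(r + s).
Local Notation v := 'cV[R]_(dimv M).

(* n_{r,s} = z (+) v; a vector is [col_mx Z X] with Z in z and X in v. *)
Local Notation n := 'cV[R]_(r + s + dimv M).

Definition sp_n (x y : n) : R :=
  sp_rs (usubmx x) (usubmx y) + formv (dsubmx x) (dsubmx y).

(* The coordinates of [X, Y] on the standard basis e_i of R^{r,s}, where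
   <e_i, e_i> = 1 or -1; the defining relation is [bracket_vE] below. *)
Definition bracket_v (X Y : v) : z :=
  \col_i (sp_rs (delta_mx i 0) (delta_mx i 0 : z)
          * formv (J M (delta_mx i 0) *m X) Y).

Definition bracket_n (x y : n) : n :=
  col_mx (bracket_v (dsubmx x) (dsubmx y)) 0.

(* The simply connected 2-step nilpotent group N_{r,s} in exponential
   coordinates: the carrier is n_{r,s}, the product is given by the
   Baker-Campbell-Hausdorff formula, the unit is 0 and p^-1 = - p. *)
Definition mul_N (p q : n) : n := p + q + 2^-1 *: bracket_n p q.

(* Differential at p of the left translation by p^-1, applied to u. *)
Definition to_identity (p u : n) : n :=
  velocity (fun t : R => mul_N (- p) (p + t *: u)) 0.

Definition metric_N : metric R (r + s + dimv M) :=
  fun p u w => sp_n (to_identity p u) (to_identity p w).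

Local Notation blocks := ('M[R]_(r + s) * 'M[R]_(dimv M))%type.

Definition mx_n (h : blocks) : 'M[R]_(r + s + dimv M) := block_mx h.1 0 0 h.2.

Definition in_H (h : blocks) : Prop :=
  [/\ orthogonal_mx (@sp_rs R r s) h.1, orthogonal_mx (@formv R r s M) h.2
    & forall Z, h.2 *m J M Z *m invmx h.2 = J M (h.1 *m Z)].

Definition in_lieH (D : blocks) : Prop :=
  [/\ skew_mx (@sp_rs R r s) D.1, skew_mx (@formv R r s M) D.2
    & forall Z, D.2 *m J M Z - J M Z *m D.2 = J M (D.1 *m Z)].

(* G = N x| H acts on N = G / H by (p, h) . q = p (h q).  Elements of G and
   of its Lie algebra g = n x| h are represented by pairs. *)
Local Notation pairs := (n * blocks)%type.

Definition in_G (a : pairs) : Prop := in_H a.2.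

Definition act_G (a : pairs) (q : n) : n := mul_N a.1 (mx_n a.2 *m q).

Definition mul_G (a b : pairs) : pairs :=
  (act_G a b.1, (a.2.1 *m b.2.1, a.2.2 *m b.2.2)).

Definition one_parameter_subgroup (a : R -> pairs) : Prop :=
  [/\ smooth_on setT (fun t => (a t).1),
      smooth_on setT (fun t => (a t).2.1),
      smooth_on setT (fun t => (a t).2.2),
      forall t, in_G (a t)
    & forall t u, a (t + u) = mul_G (a t) (a u)].

(* For every initial vector there is a geodesic c on an open interval
   [range phi] around 0, with this initial vector, such that c o phi is the
   orbit of the base point under a one-parameter subgroup of G.  In the
   pseudo-Riemannian setting the interval may be a proper part of the
   domain of the maximal geodesic. *)
Definition geodesic_orbit : Prop :=
  forall w : n, exists (c : R -> n) (phi : R -> R) (a : R -> pairs),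
    [/\ line_diffeo phi /\ phi 0 = 0,
        geodesic_on metric_N (range phi) c,
        c 0 = 0 /\ velocity c 0 = w,
        one_parameter_subgroup a
      & forall t, c (phi t) = act_G (a t) 0].

Definition in_g (x : pairs) : Prop := in_lieH x.2.

Definition in_h (x : pairs) : Prop := x.1 = 0 /\ in_lieH x.2.

Definition bracket_g (x y : pairs) : pairs :=
  (bracket_n x.1 y.1 + mx_n x.2 *m y.1 - mx_n y.2 *m x.1,
   (x.2.1 *m y.2.1 - y.2.1 *m x.2.1, x.2.2 *m y.2.2 - y.2.2 *m x.2.2)).

Definition Ad_H (h : blocks) (x : pairs) : pairs :=
  (mx_n h *m x.1,
   (h.1 *m x.2.1 *m invmx h.1, h.2 *m x.2.2 *m invmx h.2)).

Definition reductive_decomposition (m : {vspace pairs}) : Prop :=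
  [/\ forall x, x \in m -> in_g x,
      forall x, in_g x -> exists2 y, y \in m & in_h (x - y),
      forall x, x \in m -> in_h x -> x = 0
    & forall h x, in_H h -> x \in m -> Ad_H h x \in m].

(* [y] is the m-component of [x] with respect to g = h (+) m. *)
Definition m_component (m : {vspace pairs}) (x y : pairs) : Prop :=
  y \in m /\ in_h (x - y).

(* The metric at the base point, transported to m by the identification
   x |-> d/dt (exp (t x) . 0) at t = 0, that is x |-> x.1, of m with the
   tangent space n of N = G / H. *)
Definition sp_m (x y : pairs) : R := sp_n x.1 y.1.

Definition naturally_reductive : Prop :=
  exists2 m : {vspace pairs}, reductive_decomposition m &
    forall T Q S TQ TS : pairs,
      T \in m -> Q \in m -> S \in m ->
      m_component m (bracket_g T Q) TQ ->
      m_component m (bracket_g T S) TS ->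
      sp_m TQ S = - sp_m Q TS.

End PseudoHType.

Section BracketFacts.
Variables (R : realType) (r s : nat).

Lemma sp_rs_delta (i : 'I_(r + s)) (Z : 'cV[R]_(r + s)) :
  sp_rs Z (delta_mx i 0)
  = sp_rs (delta_mx i 0) (delta_mx i 0 : 'cV[R]_(r + s)) * Z i 0.
Proof.
rewrite /sp_rs; case: (splitP i) => [k|k] ik.
- have {ik} -> : i = lshift s k by apply/val_inj.
  rewrite !(bigD1 (P := xpredT) k) //= !mxE !eqxx /= !mulr1.
  rewrite ![\sum_(j < s) _]big1 ?subr0; try by move=> j _;
    rewrite !mxE eq_rlshift /= ?mulr0.
  rewrite ![\sum_(j < r | _) _]big1 ?addr0 ?mul1r //; move=> j jk;
    by rewrite !mxE (inj_eq (@lshift_inj _ _)) (negPf jk) /= ?mulr0.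
- have {ik} -> : i = rshift r k by apply/val_inj.
  rewrite ![\sum_(j < r) _]big1 ?sub0r; try by move=> j _;
    rewrite !mxE eq_lrshift /= ?mulr0.
  rewrite !(bigD1 (P := xpredT) k) //= !mxE !eqxx /= !mulr1.
  rewrite ![\sum_(j < s | _) _]big1 ?addr0 ?mulN1r //; move=> j jk;
    by rewrite !mxE (inj_eq (@rshift_inj _ _)) (negPf jk) /= ?mulr0.
Qed.

Lemma sp_rs_delta2 (i : 'I_(r + s)) :
  sp_rs (delta_mx i 0) (delta_mx i 0 : 'cV[R]_(r + s))
  * sp_rs (delta_mx i 0) (delta_mx i 0 : 'cV[R]_(r + s)) = 1.
Proof.
rewrite /sp_rs; case: (splitP i) => [k|k] ik.
- have {ik} -> : i = lshift s k by apply/val_inj.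
  rewrite !(bigD1 (P := xpredT) k) //= !mxE !eqxx /= !mulr1.
  rewrite ![\sum_(j < s) _]big1 ?subr0; try by move=> j _;
    rewrite !mxE eq_rlshift /= ?mulr0.
  by rewrite ![\sum_(j < r | _) _]big1 ?addr0 ?mul1r //; move=> j jk;
    rewrite !mxE (inj_eq (@lshift_inj _ _)) (negPf jk) /= ?mulr0.
- have {ik} -> : i = rshift r k by apply/val_inj.
  rewrite ![\sum_(j < r) _]big1 ?sub0r; try by move=> j _;
    rewrite !mxE eq_lrshift /= ?mulr0.
  rewrite !(bigD1 (P := xpredT) k) //= !mxE !eqxx /= !mulr1.
  by rewrite ![\sum_(j < s | _) _]big1 ?addr0 ?mulrNN ?mul1r //; move=> j jk;
    rewrite !mxE (inj_eq (@rshift_inj _ _)) (negPf jk) /= ?mulr0.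
Qed.

Lemma sp_rsDr (W Z1 Z2 : 'cV[R]_(r + s)) a :
  sp_rs W (a *: Z1 + Z2) = a * sp_rs W Z1 + sp_rs W Z2.
Proof.
rewrite /sp_rs mulrBr !mulr_sumr addrACA -opprD -!big_split /=.
by congr (_ - _); apply: eq_bigr => i _; rewrite !mxE mulrDr mulrCA.
Qed.

Variable M : admissible_module R r s.

Lemma formv0l (Y : 'cV[R]_(dimv M)) : formv 0 Y = 0.
Proof.
have := sp_linear (formv_sp M) 1 0 0 Y.
by rewrite scaler0 addr0 mul1r => /eqP; rewrite -subr_eq0 opprD addNKr oppr_eq0 => /eqP.
Qed.

Lemma bracket_vE (X Y : 'cV[R]_(dimv M)) (Z : 'cV[R]_(r + s)) :
  formv (J M Z *m X) Y = sp_rs (bracket_v X Y) Z.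
Proof.
have -> : Z = \sum_i Z i 0 *: delta_mx i 0.
  by rewrite [LHS]matrix_sum_delta; apply: eq_bigr => i _; rewrite big_ord1.
elim/big_rec: _ => [|i Z' _ IH].
  rewrite linear0 mul0mx formv0l /sp_rs.
  by rewrite !big1 ?subr0 // => i _; rewrite !mxE mulr0.
rewrite linearP mulmxDl -scalemxAl (sp_linear (formv_sp M)) IH sp_rsDr.
by rewrite sp_rs_delta mxE [X in _ = _ * X + _]mulrA sp_rs_delta2 mul1r.
Qed.

End BracketFacts.

(* Main.v *)
From HB Require Import structures.
From mathcomp Require Import all_boot all_order all_algebra.
From mathcomp Require Import all_classical all_reals all_analysis.
From mathcomp Require Import zify ring lra.
Require Import Defs.

(** Write [J_Z^2 = - <Z, Z>] for the Clifford action of the centre [z] on [v].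

    The geodesic orbit property is governed by an algebraic one: for all [Z] and [X]
    there are [D = (C, A)] in the isotropy algebra and a scalar [k] with
    [C Z = - k Z] and [A X + k X = J_Z X]. Necessity follows from the geodesic
    equation at the base point (geodesic_orbit_condition). Conversely, when
    [k = 0] can be taken, the orbit is the geodesic itself; the one-parameter
    subgroup is built from matrix exponentials (condition_geodesic_orbit).

    Natural reductivity holds if and only if the image of [J] is closed under
    commutators (naturally_reductive_closed, closed_naturally_reductive). For a
    reductive complement [m], the invariance of the metric, tested on one central
    and two non-central vectors, forces the derivation completing [Z] to act on [v]
    as [J_Z]; then [[J_Z, J_W] = J_(C W)]. Conversely the derivations [(C_Z, J_Z)]
    with [J_(C_Z W) = [J_Z, J_W]] define [m], and they also solve the geodesic
    orbit equations. Closure allows one generator, or three with product of squared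
    norms positive (closed_signature), which for [s >= 1] leaves (0, 1) and (1, 2).
    In signature (1, 2) closure holds because minimality makes the volume element
    [J_1 J_2 J_3] equal to [1] or [- 1] (closed_12).

    For the other signatures null vectors are an obstruction. Let [<e, e> = - 1] and
    [J_e X = X]. If [Z] is non-null and orthogonal to [e], the geodesic orbit
    equation for [(Z, X)] yields [U], orthogonal to [e] and not to [Z], with
    [J_U X = 0] (eigenvector_annihilator). So in the orthogonal complement of [e] no
    non-null vector is orthogonal to the annihilator of [X]: this annihilator is a
    maximal null subspace of a split space, that is, [r = s - 1] and every
    eigenvector is a pure spinor (hyperbolic_frame_exists). But for [r >= 4] the sum
    of a vacuum and of its image under four creation operators is not pure, and for
    [r = 2] the same is true of a suitable sum of two eigenvectors. This leaves
    [r] in 0, 1, 3 (go_signature).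

    In signature (3, 4) a module of dimension eight exists, so a minimal module
    behaves like the split octonions: [J_([X, Y]) X = <X, X> Y - <X, Y> X]
    (bracket_act). The geodesic orbit equations are linear in [D]; by duality they
    are solvable in the spin algebra unless some [(W, Y)] orthogonal to all
    [(C Z, A X)] is not orthogonal to [(0, J_Z X)], and the octonion identity excludes
    this (spin_annihilator, spin_solvable). *)

Set Implicit Arguments.
Unset Strict Implicit.
Unset Printing Implicit Defensive.

Import Order.TTheory GRing.Theory Num.Theory.
Import numFieldNormedType.Exports.

Local Open Scope classical_set_scope.
Local Open Scope ring_scope.

(** * Scalar products and the Clifford action *)

Lemma other_index (n : nat) (i : 'I_n) : (1 < n)%N -> exists j : 'I_n, j != i.
Proof.
move=> n1; have [->|i0] := eqVneq i (Ordinal (ltnW n1)).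
  by exists (Ordinal n1).
by exists (Ordinal (ltnW n1)); rewrite eq_sym.
Qed.

Section ScalarProducts.
Variables (R : realType) (n : nat) (b : 'cV[R]_n -> 'cV[R]_n -> R).
Hypothesis bP : scalar_product b.

Lemma spDl x y z : b (x + y) z = b x z + b y z.
Proof. by have := sp_linear bP 1 x y z; rewrite scale1r mul1r. Qed.

Lemma sp0l z : b 0 z = 0.
Proof. by have := spDl 0 0 z; rewrite addr0; lra. Qed.

Lemma spZl a x z : b (a *: x) z = a * b x z.
Proof. by have := sp_linear bP a x 0 z; rewrite addr0 sp0l addr0. Qed.

Lemma spNl x z : b (- x) z = - b x z.
Proof. by rewrite -scaleN1r spZl mulN1r. Qed.

Lemma spDr x y z : b z (x + y) = b z x + b z y.
Proof. by rewrite !(sp_sym bP z) spDl. Qed.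

Lemma sp0r z : b z 0 = 0.
Proof. by rewrite (sp_sym bP) sp0l. Qed.

Lemma spZr a x z : b z (a *: x) = a * b z x.
Proof. by rewrite !(sp_sym bP z) spZl. Qed.

Lemma spNr x z : b z (- x) = - b z x.
Proof. by rewrite !(sp_sym bP z) spNl. Qed.

Definition spE := (spDl, spDr, spZl, spZr, spNl, spNr, sp0l, sp0r).

Lemma sp_suml (I : Type) (s : seq I) (P : pred I) (F : I -> 'cV[R]_n) z :
  b (\sum_(i <- s | P i) F i) z = \sum_(i <- s | P i) b (F i) z.
Proof.
by elim/big_rec2: _ => [|i u v _ <-]; rewrite ?sp0l ?spDl.
Qed.

Lemma sp_sumr (I : Type) (s : seq I) (P : pred I) (F : I -> 'cV[R]_n) z :
  b z (\sum_(i <- s | P i) F i) = \sum_(i <- s | P i) b z (F i).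
Proof. by rewrite (sp_sym bP) sp_suml; apply: eq_bigr => i _; rewrite (sp_sym bP). Qed.

Lemma sp_inj x y : (forall z, b x z = b y z) -> x = y.
Proof.
move=> xy; apply/eqP; rewrite -subr_eq0; apply/eqP/(sp_nondeg bP) => z.
by rewrite !spE xy subrr.
Qed.

Lemma sp_neq0 x : x != 0 -> exists y, b x y != 0.
Proof.
move=> x0; apply: contrapT => H; move/eqP: x0; apply; apply: (sp_nondeg bP) => y.
by apply/eqP/negP => /negP xy; apply: H; exists y.
Qed.

(** By polarisation, a form vanishing on the diagonal vanishes. *)
Lemma sp_nonnull : (0 < n)%N -> exists x, b x x != 0.
Proof.
move=> n0; apply: contrapT => H.
have b0 x : b x x = 0 by apply/eqP/negP => /negP xx; apply: H; exists x.
have b1 x y : b x y = 0.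
  by have := b0 (x + y); rewrite !spE !b0 (sp_sym bP y x); lra.
have /matrixP/(_ (Ordinal n0) 0) := sp_nondeg bP (b1 (const_mx 1)).
by rewrite !mxE; lra.
Qed.

Definition gram := \matrix_(i, j) b (delta_mx i 0) (delta_mx j 0).

Lemma gramE x y : b x y = (x^T *m gram *m y) 0 0.
Proof.
have col (z : 'cV[R]_n) : z = \sum_i z i 0 *: delta_mx i 0.
  by rewrite [LHS]matrix_sum_delta; apply: eq_bigr => i _; rewrite big_ord1.
rewrite {1}[y]col sp_sumr mxE; apply: eq_bigr => j _.
rewrite spZr mulrC {1}[x]col sp_suml mxE; congr (_ * _); apply: eq_bigr => i _.
by rewrite spZl !mxE.
Qed.

Lemma gram_unit : gram \in unitmx.
Proof.
rewrite -row_free_unit -kermx_eq0; apply/eqP/row_matrixP => i; rewrite row0.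
apply: trmx_inj; rewrite trmx0; apply: (sp_nondeg bP) => y.
by rewrite gramE trmxK -row_mul mulmx_ker row0 mul0mx mxE.
Qed.

Lemma sp_riesz (y : 'cV[R]_n) : exists w, forall x, b x w = (x^T *m y) 0 0.
Proof.
by exists (invmx gram *m y) => x; rewrite gramE -mulmxA mulKVmx ?gram_unit.
Qed.

Lemma orthogonal_unit (A : 'M[R]_n) : orthogonal_mx b A -> A \in unitmx.
Proof.
move=> Ab; rewrite -unitmx_tr -row_free_unit -kermx_eq0.
apply/eqP/row_matrixP => i; rewrite row0; apply: trmx_inj; rewrite trmx0.
apply: (sp_nondeg bP) => y; rewrite -Ab -[A]trmxK -trmx_mul trmxK -row_mul.
by rewrite mulmx_ker row0 trmx0 sp0l.
Qed.

End ScalarProducts.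

Lemma mx_ext (R : realType) m n (A B : 'M[R]_(m, n)) :
  (forall x : 'cV_n, A *m x = B *m x) -> A = B.
Proof.
move=> AB; apply/matrixP => i j.
by have /colP/(_ i) := AB (delta_mx j 0); rewrite -!colE !mxE.
Qed.

Section LinearMaps.
Variables (R : realType) (n m : nat) (f : 'cV[R]_n -> 'cV[R]_m).

Definition mx_of := \matrix_(i, j) f (delta_mx j 0) i 0.

Lemma mx_ofE : (forall a x y, f (a *: x + y) = a *: f x + f y) ->
  forall x, mx_of *m x = f x.
Proof.
move=> fP x; have f0 : f 0 = 0 by have := fP (-1) 0 0; rewrite scaler0 addr0 scaleN1r addNr.
have -> : x = \sum_i x i 0 *: delta_mx i 0.
  by rewrite [LHS]matrix_sum_delta; apply: eq_bigr => i _; rewrite big_ord1.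
elim/big_rec: _ => [|i y _ IH]; first by rewrite mulmx0 f0.
rewrite mulmxDr -scalemxAr fP IH; congr (_ *: _ + _); apply/colP => k.
rewrite mxE (bigD1 i) //= !mxE !eqxx mulr1 big1 ?addr0 // => j ji.
by rewrite !mxE (negPf ji) mulr0.
Qed.

End LinearMaps.

Section Centre.
Variables (R : realType) (r s : nat).
Implicit Types U V Z : 'cV[R]_(r + s).

Lemma sp_rs_mx U V :
  sp_rs U V = ((usubmx U)^T *m usubmx V - (dsubmx U)^T *m dsubmx V) 0 0.
Proof.
by rewrite !mxE /sp_rs; congr (_ - _); apply: eq_bigr => i _; rewrite !mxE.
Qed.

Lemma sp_rsP : scalar_product (@sp_rs R r s).
Proof.
have sym U V : sp_rs U V = sp_rs V U.
  by rewrite /sp_rs; congr (_ - _); apply: eq_bigr => i _; rewrite mulrC.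
split=> // [a x y z | Z H].
  by rewrite sym sp_rsDr !(sym z).
apply/colP => i; rewrite mxE.
have e2 := @sp_rs_delta2 R r s i.
have := sp_rs_delta i Z; rewrite H => /esym/eqP; rewrite mulf_eq0.
by case/orP => /eqP // e0; move: e2; rewrite e0 mul0r => /eqP; rewrite eq_sym oner_eq0.
Qed.

Lemma sp_rs_unit (i : 'I_(r + s)) :
  sp_rs (delta_mx i 0) (delta_mx i 0 : 'cV[R]_(r + s)) != 0.
Proof.
apply/negP => /eqP e0; have := @sp_rs_delta2 R r s i.
by rewrite e0 mul0r => /eqP; rewrite eq_sym oner_eq0.
Qed.

Lemma sp_rs_perp (i j : 'I_(r + s)) : i != j ->
  sp_rs (delta_mx i 0) (delta_mx j 0 : 'cV[R]_(r + s)) = 0.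
Proof. by move=> ij; rewrite sp_rs_delta mxE eq_sym (negPf ij) mulr0. Qed.

Lemma sp_rs_lshift (i : 'I_r) :
  sp_rs (delta_mx (lshift s i) 0) (delta_mx (lshift s i) 0 : 'cV[R]_(r + s)) = 1.
Proof.
rewrite /sp_rs (bigD1 i) //= !mxE !eqxx mulr1 !big1 ?addr0 ?subr0 // => j ji;
  by rewrite !mxE ?eq_rlshift ?(inj_eq (@lshift_inj _ _)) ?(negPf ji) /= ?mul0r.
Qed.

Lemma sp_rs_rshift (j : 'I_s) :
  sp_rs (delta_mx (rshift r j) 0) (delta_mx (rshift r j) 0 : 'cV[R]_(r + s)) = -1.
Proof.
rewrite /sp_rs (bigD1 (P := xpredT) (F := fun k => _ (rshift r k) 0 * _) j) //= !mxE !eqxx mulr1.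
rewrite !big1 ?addr0 ?sub0r // => i ji;
  by rewrite !mxE ?eq_lrshift ?(inj_eq (@rshift_inj _ _)) ?(negPf ji) /= ?mul0r.
Qed.

End Centre.

Section CliffordAction.
Variables (R : realType) (r s : nat) (M : admissible_module R r s).
Implicit Types (U V Z : 'cV[R]_(r + s)) (X Y : 'cV[R]_(dimv M)).

Local Notation "Z ** X" := (J M Z *m X) (at level 41, right associativity).
Local Notation spv := (formv_sp M).
Local Notation spz := (@sp_rsP R r s).

Lemma actDl U V X : (U + V) ** X = U ** X + V ** X.
Proof. by rewrite linearD mulmxDl. Qed.

Lemma actZl a U X : (a *: U) ** X = a *: (U ** X).
Proof. by rewrite linearZ -scalemxAl. Qed.

Lemma actNl U X : (- U) ** X = - (U ** X).
Proof. by rewrite linearN mulNmx. Qed.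

Lemma act0l X : 0 ** X = 0.
Proof. by rewrite linear0 mul0mx. Qed.

Lemma actDr U X Y : U ** (X + Y) = U ** X + U ** Y.
Proof. exact: mulmxDr. Qed.

Lemma actZr a U X : U ** (a *: X) = a *: (U ** X).
Proof. by rewrite scalemxAr. Qed.

Lemma actNr U X : U ** (- X) = - (U ** X).
Proof. exact: mulmxN. Qed.

Lemma act0r U : U ** (0 : 'cV_(dimv M)) = 0.
Proof. exact: mulmx0. Qed.

Definition actE := (actDl, actZl, actNl, act0l, actDr, actZr, actNr, act0r).

(** The relation [J_Z ^ 2 = - <Z, Z>], polarised. *)
Lemma J_anticomm U V : J M U *m J M V + J M V *m J M U = (- (2 * sp_rs U V))%:M.
Proof.
have := J_clifford M (U + V).
rewrite linearD mulmxDl !mulmxDr !J_clifford !(spE spz) (sp_sym spz V U).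
move=> /matrixP H; apply/matrixP => i j; have := H i j; rewrite !mxE.
by case: (i == j); rewrite ?mulr1n ?mulr0n; lra.
Qed.

Lemma J_delta_anticomm (i j : 'I_(r + s)) : i != j ->
  J M (delta_mx i 0) *m J M (delta_mx j 0) = - (J M (delta_mx j 0) *m J M (delta_mx i 0)).
Proof.
move=> ij; have := J_anticomm (delta_mx i 0) (delta_mx j 0).
by rewrite sp_rs_perp // mulr0 oppr0 raddf0 => /eqP; rewrite addr_eq0 => /eqP.
Qed.

Lemma act_anticomm U V X : U ** V ** X = - (V ** U ** X) - (2 * sp_rs U V) *: X.
Proof.
have := congr1 (mulmx^~ X) (J_anticomm U V).
rewrite mulmxDl mul_scalar_mx scaleNr -!mulmxA => /(canRL (addrK _)) ->.
by rewrite addrC.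
Qed.

Lemma act_sq U X : U ** U ** X = - sp_rs U U *: X.
Proof. by rewrite mulmxA J_clifford mul_scalar_mx. Qed.

Lemma act_skew U X Y : formv (U ** X) Y = - formv X (U ** Y).
Proof. exact: J_skew. Qed.

Lemma act_isotropic U X : formv (U ** X) X = 0.
Proof. by have := act_skew U X X; rewrite (sp_sym spv X); lra. Qed.

(** This is what makes [J] behave like a multiplication of composition algebras:
    a non-null [X] maps the centre to [v] by a similarity. *)
Lemma act_form U V X : formv (U ** X) (V ** X) = sp_rs U V * formv X X.
Proof.
have := congr1 (formv X) (act_anticomm U V X).
have := act_skew U X (V ** X); have := act_skew V X (U ** X).
by rewrite !(spE spv) (sp_sym spv (V ** X)); lra.
Qed.

Lemma act_eq0 U X : sp_rs U U != 0 -> U ** X = 0 -> X = 0.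
Proof.
move=> UU UX; have := act_sq U X; rewrite UX act0r => /esym/eqP.
by rewrite scaler_eq0 oppr_eq0 (negPf UU) => /eqP.
Qed.

Lemma J_inj U V : (0 < dimv M)%N -> J M U = J M V -> U = V.
Proof.
move=> d0 UV; apply: (sp_inj spz) => Z.
have := J_anticomm (U - V) Z; rewrite linearB UV subrr mul0mx mulmx0 addr0.
move=> /matrixP/(_ (Ordinal d0) (Ordinal d0)); rewrite !mxE eqxx mulr1n !(spE spz).
by lra.
Qed.

Lemma bracketE X Y Z : sp_rs (bracket_v X Y) Z = formv (Z ** X) Y.
Proof. by rewrite bracket_vE. Qed.

Lemma bracketC X Y : bracket_v Y X = - bracket_v X Y.
Proof.
apply: (sp_inj spz) => Z; rewrite (spE spz) !bracketE act_skew.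
by rewrite (sp_sym spv).
Qed.

Lemma bracketDl X X' Y : bracket_v (X + X') Y = bracket_v X Y + bracket_v X' Y.
Proof. by apply: (sp_inj spz) => Z; rewrite (spE spz) !bracketE actDr (spE spv). Qed.

Lemma bracketZl a X Y : bracket_v (a *: X) Y = a *: bracket_v X Y.
Proof. by apply: (sp_inj spz) => Z; rewrite (spE spz) !bracketE actZr (spE spv). Qed.

Lemma bracketDr X X' Y : bracket_v Y (X + X') = bracket_v Y X + bracket_v Y X'.
Proof. by rewrite ![bracket_v Y _]bracketC bracketDl opprD. Qed.

Lemma bracketZr a X Y : bracket_v Y (a *: X) = a *: bracket_v Y X.
Proof. by rewrite ![bracket_v Y _]bracketC bracketZl scalerN. Qed.

Lemma bracket0r X : bracket_v X 0 = 0 :> 'cV_(r + s).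
Proof. by have := bracketZr 0 0 X; rewrite !scale0r. Qed.

End CliffordAction.

(** * The isotropy algebra *)

Section IsotropyAlgebra.
Variables (R : realType) (r s : nat) (M : admissible_module R r s).
Local Notation blocks := ('M[R]_(r + s) * 'M[R]_(dimv M))%type.
Implicit Types (U V Z : 'cV[R]_(r + s)) (X Y : 'cV[R]_(dimv M)) (D : blocks).

Local Notation "Z ** X" := (J M Z *m X) (at level 41, right associativity).
Local Notation spv := (formv_sp M).
Local Notation spz := (@sp_rsP R r s).

Lemma in_lieH_act D Z X : in_lieH D -> D.2 *m (Z ** X) = (D.1 *m Z) ** X + Z ** (D.2 *m X).
Proof.
case=> _ _ /(_ Z) H; rewrite !mulmxA -mulmxDl -H subrK //.
Qed.

Lemma in_lieH0 : @in_lieH R r s M (0, 0).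
Proof.
split=> [x y|x y|Z] /=; rewrite !mul0mx ?(spE spz) ?(spE spv) ?oppr0 //.
by rewrite mulmx0 subrr linear0.
Qed.

Lemma in_lieHP a D D' : in_lieH D -> in_lieH D' -> in_lieH (a *: D + D').
Proof.
move=> [C1 A1 H1] [C2 A2 H2]; split=> [x y|x y|Z] /=.
- by rewrite !mulmxDl -!scalemxAl !(spE spz) C1 C2; lra.
- by rewrite !mulmxDl -!scalemxAl !(spE spv) A1 A2; lra.
- rewrite [in RHS]mulmxDl -scalemxAl (linearP (J M)) -H1 -H2 scalerBr.
  by rewrite mulmxDl mulmxDr -scalemxAl -scalemxAr opprD addrACA.
Qed.

Lemma in_lieHB D D' : in_lieH D -> in_lieH D' -> in_lieH (D - D').
Proof. by move=> DH D'H; rewrite addrC -scaleN1r; apply: in_lieHP. Qed.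

Lemma in_lieH_comm D D' : in_lieH D -> in_lieH D' ->
  in_lieH (D.1 *m D'.1 - D'.1 *m D.1, D.2 *m D'.2 - D'.2 *m D.2).
Proof.
move=> DH D'H; case: DH D'H => [C1 A1 H1] [C2 A2 H2]; split=> [x y|x y|Z] /=.
- by rewrite !mulmxBl -!mulmxA !(spE spz) !(C1, C2); lra.
- by rewrite !mulmxBl -!mulmxA !(spE spv) !(A1, A2); lra.
rewrite [in RHS]mulmxBl -!mulmxA (linearB (J M)) -!(H1, H2).
rewrite !mulmxBl !mulmxBr !mulmxA; set A := D.2; set A' := D'.2; set Jz := J M Z.
move: (A *m A' *m Jz) (A' *m A *m Jz) (Jz *m A *m A') (Jz *m A' *m A) => a1 a2 a3 a4.
move: (A *m Jz *m A') (A' *m Jz *m A) => a5 a6.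
by apply/matrixP => i j; rewrite !mxE; lra.
Qed.

Lemma in_lieH_sum (T : finType) (c : T -> R) (D : T -> blocks) :
  (forall t, in_lieH (D t)) -> in_lieH (\sum_t c t *: D t).
Proof.
move=> DH; elim/big_ind: _ => [|D1 D2 H1 H2|t _]; first exact: in_lieH0.
  by rewrite -[D1]scale1r; apply: in_lieHP.
by rewrite -[_ *: _]addr0; apply: in_lieHP => //; exact: in_lieH0.
Qed.

Local Notation n := 'cV[R]_(r + s + dimv M).

Lemma mx_nE D Z X : mx_n D *m col_mx Z X = col_mx (D.1 *m Z) (D.2 *m X).
Proof. by rewrite mul_block_col !mul0mx addr0 add0r. Qed.

Lemma bracket_nE Z X W Y :
  bracket_n (col_mx Z X) (col_mx W Y) = col_mx (bracket_v X Y) 0 :> n.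
Proof. by rewrite /bracket_n !col_mxKd. Qed.

Lemma sp_nE Z X W Y :
  sp_n (col_mx Z X : n) (col_mx W Y) = sp_rs Z W + formv X Y.
Proof. by rewrite /sp_n !col_mxKu !col_mxKd. Qed.

End IsotropyAlgebra.

(** * Natural reductivity *)

Section NaturalReductivity.
Variables (R : realType) (r s : nat) (M : admissible_module R r s).
Local Notation n := 'cV[R]_(r + s + dimv M).
Local Notation blocks := ('M[R]_(r + s) * 'M[R]_(dimv M))%type.
Local Notation pairs := (n * blocks)%type.
Implicit Types (U V Z W : 'cV[R]_(r + s)) (X Y : 'cV[R]_(dimv M)) (D : blocks).

Local Notation spv := (formv_sp M).
Local Notation spz := (@sp_rsP R r s).

Definition commutator_closed :=
  forall Z W, exists V, J M Z *m J M W - J M W *m J M Z = J M V.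

(** Testing the invariance of the metric on one central and two
    non-central directions shows that the central vector [Z] is completed
    to an element of [m] by a derivation acting on [v] as [J_Z]. *)
Lemma naturally_reductive_closed : naturally_reductive M -> commutator_closed.
Proof.
case=> m [mg gm mh _] inv.
have lift (u : n) : exists2 x : pairs, x \in m & x.1 = u.
  have ug : in_g (u, (0, 0) : blocks) by exact: in_lieH0.
  have [y ym [/eqP + _]] := gm _ ug; rewrite subr_eq0 => /eqP yu.
  by exists y.
have comp x y : x \in m -> y \in m ->
    exists2 z : pairs, m_component m (bracket_g x y) z & z.1 = (bracket_g x y).1.
  move=> /mg xg /mg yg; have /gm[z zm zh] : in_g (bracket_g x y).
    exact: in_lieH_comm.
  by exists z => //; case: zh => /eqP + _; rewrite subr_eq0 => /eqP.
move=> Z W; have [q qm q1] := lift (col_mx Z 0).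
have qJ : q.2.2 = J M Z.
  suff H X : q.2.2 *m X = J M Z *m X.
    exact: mx_ext.
  apply: (sp_inj spv) => Y.
  have [t tm t1] := lift (col_mx 0 X); have [u um u1] := lift (col_mx 0 Y).
  have [tq tqm tq1] := comp _ _ tm qm; have [tu tum tu1] := comp _ _ tm um.
  have := inv _ _ _ _ _ tm qm um tqm tum; rewrite /sp_m tq1 tu1 /= t1 q1 u1.
  rewrite !bracket_nE bracket0r !mx_nE !mulmx0 !opp_col_mx !add_col_mx !sp_nE.
  rewrite !(spE spv) !(spE spz) !addr0 !add0r ?oppr0 ?addr0 (sp_sym spz) bracketE.
  by lra.
exists (q.2.1 *m W); case: (mg _ qm) => _ _ /(_ W) <-.
by rewrite qJ.
Qed.

Section Complement.
Hypothesis d0 : (0 < dimv M)%N.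
Hypothesis closed : commutator_closed.

(** The operator [C_Z] with [J_(C_Z W) = [J_Z, J_W]]; on [v] the same derivation
    acts as [J_Z] itself. *)
Definition adJ Z : 'M[R]_(r + s) := mx_of (projT1 (choice (closed Z))).

Lemma adJE Z W : J M (adJ Z *m W) = J M Z *m J M W - J M W *m J M Z.
Proof.
rewrite /adJ; case: choice => c /= cE.
rewrite mx_ofE // => a x y; apply: (J_inj d0).
rewrite (linearP (J M)) -!cE (linearP (J M)) mulmxDl mulmxDr -scalemxAl -scalemxAr.
by rewrite scalerBr opprD addrACA.
Qed.

Lemma adJ_linear : linear adJ.
Proof.
move=> a Z1 Z2; apply: mx_ext => W; apply: (J_inj d0).
rewrite mulmxDl -scalemxAl (linearP (J M)) !adJE (linearP (J M)).
by rewrite mulmxDl mulmxDr -scalemxAl -scalemxAr scalerBr opprD addrACA.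
Qed.

(** Skew-symmetry on the centre is the invariance of the anticommutator:
    [{[J_Z, J_x], J_y} + {J_x, [J_Z, J_y]} = [J_Z, {J_x, J_y}] = 0]. *)
Lemma in_lieH_adJ Z : in_lieH (adJ Z, J M Z).
Proof.
split=> [x y|x y|W] /=; last by rewrite adJE.
  have P V V' : 2 * sp_rs V V' *: (1%:M : 'M[R]_(dimv M))
      = - (J M V *m J M V' + J M V' *m J M V).
    by rewrite J_anticomm scalemx1 raddfN opprK.
  suff: 2 * sp_rs (adJ Z *m x) y *: (1%:M : 'M[R]_(dimv M))
      = - (2 * sp_rs x (adJ Z *m y)) *: 1%:M.
    move=> /matrixP/(_ (Ordinal d0) (Ordinal d0)); rewrite !mxE eqxx mulr1n; lra.
  rewrite scaleNr !P !adJE !mulmxBl !mulmxBr !mulmxA.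
  have := congr1 (mulmx (J M Z)) (J_anticomm M x y).
  have := congr1 (mulmx^~ (J M Z)) (J_anticomm M x y).
  rewrite /= mul_scalar_mx mul_mx_scalar => <-; rewrite mulmxDl mulmxDr !mulmxA.
  set A := J M x; set B := J M y; set C := J M Z.
  move: (A *m B *m C) (B *m A *m C) (C *m A *m B) (C *m B *m A) => a1 a2 a3 a4.
  move: (A *m C *m B) (B *m C *m A) => a5 a6 /matrixP H.
  by apply/matrixP => i j; have := H i j; rewrite !mxE; lra.
exact: J_skew.
Qed.

Lemma closed_self Z : adJ Z *m Z = 0.
Proof. by apply: (J_inj d0); rewrite adJE subrr linear0. Qed.

(** The parametrisation of the complement [m] by [n] that is forced by
    invariance: the central part of [u] determines the derivation. *)
Definition m_lift (u : n) : pairs := (u, (adJ (usubmx u), J M (usubmx u))).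

Lemma m_lift_linear : linear m_lift.
Proof.
move=> a u v; rewrite /m_lift linearP adJ_linear linearP.
by [].
Qed.

HB.instance Definition _ := GRing.isLinear.Build R n pairs _ m_lift m_lift_linear.

(** The metric is invariant on [m] because [A_Z = J_Z] compensates the bracket
    of [v] and because [(U, V, W) |-> <C_U V, W>] is alternating. The isotropy
    group preserves [m] since it conjugates [J_Z] to [J_(phi Z)]. *)
Lemma closed_naturally_reductive : naturally_reductive M.
Proof.
have mem x : x \in limg (linfun m_lift) -> x = m_lift x.1.
  by case/memv_imgP => u _ ->; rewrite lfunE.
have mem_lift u : m_lift u \in limg (linfun m_lift).
  by apply/memv_imgP; exists u; rewrite ?memvf ?lfunE.
exists (limg (linfun m_lift)).
  split=> [x /mem ->|x xg|x /mem -> [/= -> _]|h x [h1 h2 h3] /mem ->].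
  - exact: in_lieH_adJ.
  - exists (m_lift x.1) => //; split; first exact: subrr.
    by apply: in_lieHB xg _; exact: in_lieH_adJ.
  - exact: linear0.
  suff -> : Ad_H h (m_lift x.1) = m_lift (mx_n h *m x.1) by [].
  have u1 := orthogonal_unit spz h1; have u2 := orthogonal_unit spv h2.
  rewrite -[x.1]vsubmxK mx_nE /Ad_H /m_lift /= mx_nE !col_mxKu h3; congr (_, (_, _)).
  apply: mx_ext => W; apply: (J_inj d0).
  rewrite -[W](mulKVmx u1) -!mulmxA mulKmx //; move: (invmx h.1 *m W) => V.
  rewrite -h3 !adJE -!h3 mulmxBr mulmxBl.
  by rewrite !mulmxA !(mulmxKV u2).
move=> T Q S TQ TS /mem -> /mem -> /mem -> [TQm [TQ1 _]] [TSm [TS1 _]].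
have {TQ1}-> : TQ = m_lift (bracket_g (m_lift T.1) (m_lift Q.1)).1.
  by rewrite (mem _ TQm); congr m_lift; apply/eqP; rewrite eq_sym -subr_eq0; apply/eqP.
have {TS1}-> : TS = m_lift (bracket_g (m_lift T.1) (m_lift S.1)).1.
  by rewrite (mem _ TSm); congr m_lift; apply/eqP; rewrite eq_sym -subr_eq0; apply/eqP.
rewrite /sp_m /=; move: T.1 Q.1 S.1 => t q u.
rewrite -[t]vsubmxK -[q]vsubmxK -[u]vsubmxK !col_mxKu !bracket_nE !mx_nE /=.
rewrite !opp_col_mx !add_col_mx !sp_nE.
move: (usubmx t) (usubmx q) (usubmx u) (dsubmx t) (dsubmx q) (dsubmx u).
move=> tz qz uz tx qx ux.
have skew V W : adJ V *m W = - (adJ W *m V).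
  by apply: (J_inj d0); rewrite linearN !adJE opprB.
have sz V x y := let: And3 H _ _ := in_lieH_adJ V in H x y.
have sx V x y := let: And3 _ H _ := in_lieH_adJ V in H x y.
rewrite !(spE spv) !(spE spz) !(skew _ tz) !(spE spz) bracketE (sp_sym spz qz) bracketE.
by rewrite (sp_sym spv qx (J M uz *m tx)); have := sz tz qz uz; have := sx tz qx ux => /=; lra.
Qed.

End Complement.

(** The commutator of two anticommuting generators is twice their product,
    so closure says that [J_i J_j] is again in the image of [J]. Such an element
    is orthogonal to [e_i] and [e_j], and commutes with every other generator, which
    is then a multiple of its inverse: two other generators would be proportional. *)
Lemma closed_basis_pair (i j : 'I_(r + s)) :
  (0 < dimv M)%N -> commutator_closed -> i != j ->
  exists V, [/\ V i 0 = 0, V j 0 = 0,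
    sp_rs V V = 4 * sp_rs (delta_mx i 0) (delta_mx i 0 : 'cV[R]_(r + s))
                  * sp_rs (delta_mx j 0) (delta_mx j 0 : 'cV[R]_(r + s))
  & forall k l, k != l -> k != i -> k != j -> l != i -> l != j -> V k 0 = 0].
Proof.
move=> d0 closed ij; pose E k := J M (delta_mx k 0).
pose e k := sp_rs (delta_mx k 0) (delta_mx k 0 : 'cV[R]_(r + s)).
have EE k : E k *m E k = (- e k)%:M by exact: J_clifford.
have EC k l : k != l -> E k *m E l = - (E l *m E k) by exact: J_delta_anticomm.
have [V VE] := closed (delta_mx i 0) (delta_mx j 0).
have {}VE : J M V = 2 *: (E i *m E j).
  by rewrite -VE -/(E i) -/(E j) [E j *m _]EC 1?eq_sym // opprK scaler_nat mulr2n.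
have spVe k : sp_rs V (delta_mx k 0) = e k * V k 0 by rewrite sp_rs_delta.
(* Anticommuting with a generator means being orthogonal to it. *)
have V0 k : J M V *m E k = - (E k *m J M V) -> V k 0 = 0.
  move=> H; have := J_anticomm M V (delta_mx k 0); rewrite -/(E k) H addNr spVe.
  move=> /matrixP/(_ (Ordinal d0) (Ordinal d0)); rewrite !mxE eqxx mulr1n => /eqP.
  rewrite eq_sym oppr_eq0 !mulf_eq0 (negPf (sp_rs_unit _ k)) pnatr_eq0 /=.
  by move/eqP.
have VV : sp_rs V V = 4 * e i * e j.
  have := J_clifford M V; rewrite VE -scalemxAl -scalemxAr scalerA.
  rewrite -mulmxA (mulmxA (E j)) [E j *m E i]EC 1?eq_sym // mulNmx mulmxN.
  rewrite -mulmxA EE mulmxA EE.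
  move=> /matrixP/(_ (Ordinal d0) (Ordinal d0)).
  by rewrite -scalar_mxM !mxE eqxx !mulr1n -/(e i) -/(e j); lra.
exists V; split.
- apply: V0; rewrite VE -!scalemxAl -!scalemxAr -mulmxA [E j *m _]EC 1?eq_sym //.
  by rewrite mulmxN scalerN.
- apply: V0; rewrite VE -!scalemxAl -!scalemxAr mulmxA [E j *m E i]EC 1?eq_sym //.
  by rewrite mulNmx scalerN opprK.
- exact: VV.
move=> k l kl ki kj li lj.
(* [J_V] commutes with [E_m] and their anticommutator is a scalar, so [E_m] is
   proportional to the inverse of [J_V]. *)
have VC m : m != i -> m != j -> J M V *m E m = (- (e m * V m 0))%:M.
  move=> mi mj; have := J_anticomm M V (delta_mx m 0); rewrite -/(E m) spVe.
  have -> : E m *m J M V = J M V *m E m.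
    rewrite VE -scalemxAr -scalemxAl [in LHS]mulmxA [E m *m E i]EC // mulNmx.
    by rewrite -[in LHS]mulmxA [E m *m E j]EC // mulmxN opprK mulmxA.
  move/matrixP => H; apply/matrixP => p q; have := H p q; rewrite !mxE.
  by case: (p == q); rewrite ?mulr1n ?mulr0n; lra.
have /(J_inj d0)/colP/(_ l) : J M ((e l * V l 0) *: delta_mx k 0)
    = J M ((e k * V k 0) *: delta_mx l 0).
  have VV0 : sp_rs V V != 0.
    by rewrite VV mulf_neq0 ?mulf_neq0 ?sp_rs_unit ?pnatr_eq0.
  have : J M V *m (J M V *m J M ((e l * V l 0) *: delta_mx k 0))
      = J M V *m (J M V *m J M ((e k * V k 0) *: delta_mx l 0)).
    congr (_ *m _); rewrite !linearZ /= -/(E k) -/(E l) !VC //.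
    by rewrite !scale_scalar_mx; congr (_%:M); ring.
  rewrite !mulmxA J_clifford !mul_scalar_mx => /(scalerI _); apply.
  by rewrite oppr_eq0.
rewrite !mxE !eqxx [l == k]eq_sym (negPf kl) /= mulr0 mulr1 => /esym/eqP.
by rewrite mulf_eq0 (negPf (sp_rs_unit _ k)) => /eqP.
Qed.

End NaturalReductivity.

(** * Signatures and modules closed under commutators *)

Section ClosedSignatures.
Variables (R : realType) (r s : nat) (M : admissible_module R r s).
Hypothesis d0 : (0 < dimv M)%N.
Hypothesis s0 : (1 <= s)%N.

Local Notation spz := (@sp_rsP R r s).
Local Notation e k := (sp_rs (delta_mx k 0) (delta_mx k 0 : 'cV[R]_(r + s))).

(** Hence two generators determine a third one, there is no fourth, and
    [(J_i J_j) ^ 2 = - J_i ^ 2 J_j ^ 2] makes the product of the three squared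
    norms positive: the centre is the imaginary part of a quaternion algebra. *)
Lemma closed_triple (i j : 'I_(r + s)) : commutator_closed M -> i != j ->
  exists k, [/\ uniq [:: i; j; k], forall l, l \in [:: i; j; k] & 0 < e i * e j * e k].
Proof.
move=> closed ij; have [V [Vi Vj VV Vkl]] := closed_basis_pair d0 closed ij.
have /cV0Pn[k Vk] : V != 0.
  apply/eqP => V0; move: VV; rewrite V0 (sp0l spz) => /esym/eqP.
  by rewrite !mulf_eq0 pnatr_eq0 /= !(negPf (sp_rs_unit _ _)).
have ki : k != i by apply: contraNneq Vk => ->; rewrite Vi.
have kj : k != j by apply: contraNneq Vk => ->; rewrite Vj.
exists k; split=> [|l|].
- by rewrite /= !inE negb_or ij eq_sym ki eq_sym kj.
- rewrite !inE; have [//|li] := eqVneq l i; have [//|lj] := eqVneq l j => /=.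
  apply: contraNT Vk => lk; apply/eqP; apply: (Vkl k l) => //.
  by rewrite eq_sym.
have : V = V k 0 *: delta_mx k 0.
  apply/colP => l; rewrite !mxE eqxx andbT; have [->|lk] := eqVneq l k.
    by rewrite mulr1.
  have [->|li] := eqVneq l i; first by rewrite Vi mulr0.
  have [->|lj] := eqVneq l j; first by rewrite Vj mulr0.
  by rewrite mulr0; apply: (Vkl l k).
move=> VE; move: VV; rewrite VE !(spE spz) => H.
have := sp_rs_delta2 R k; have : 0 < V k 0 ^+ 2 by rewrite exprn_even_gt0.
move: (e i) (e j) (e k) H => x y z H v2 zz.
suff : 0 < 4 * (x * y * z) by rewrite pmulr_rgt0.
suff -> : 4 * (x * y * z) = V k 0 ^+ 2 by [].
by transitivity (4 * x * y * z); [ring|rewrite -H; transitivity (V k 0 ^+2 * (z * z)); [ring|rewrite zz mulr1]].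
Qed.

Lemma closed_signature : commutator_closed M ->
  (r, s) = (0, 1)%N \/ (r, s) = (1, 2)%N.
Proof.
move=> closed; have i0 : (r < r + s)%N by rewrite -[X in (X < _)%N]addn0 ltn_add2l.
have [n1|n1] := leqP (r + s) 1.
  by left; congr (_, _); lia.
pose i : 'I_(r + s) := rshift r (Ordinal s0).
have [j ji] := other_index i n1; rewrite eq_sym in ji.
have [k [/= u cover pos]] := closed_triple closed ji.
have rs3 : (r + s = 3)%N.
  rewrite -[LHS]card_ord; transitivity #|[:: i; j; k]|.
    by apply: eq_card => l; rewrite cover.
  exact/card_uniqP.
have ei : e i = -1 by exact: sp_rs_rshift.
move: u; rewrite /= !inE negb_or => /and3P[/andP[_ ik] jk _].
right; move: pos; rewrite ei.
have [r0|r1] := posnP r.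
  have sgn0 (l : 'I_(r + s)) : e l = -1.
    case: (split_ordP l) => m ->; last exact: sp_rs_rshift.
    by have := ltn_ord m; rewrite {2}r0.
  by rewrite !sgn0 !mulrN1 opprK ltr0N1.
have [s1|s2] := leqP s 1.
  have sgn1 (l : 'I_(r + s)) : i != l -> e l = 1.
    case: (split_ordP l) => m -> il; first exact: sp_rs_lshift.
    case/negP: il; apply/eqP; congr rshift; apply/val_inj => /=.
    by have := ltn_ord m; have := leq_trans (ltn_ord m) s1; case: (val m).
  by rewrite !sgn1 // !mulr1 ltr0N1.
by move=> _; congr (_, _); lia.
Qed.

End ClosedSignatures.

Section MinimalModules.
Variables (R : realType) (r s : nat) (M : admissible_module R r s).

Local Notation spv := (formv_sp M).

(** The range of a self-adjoint projection commuting with the Clifford action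
    is a non-degenerate submodule, so it cannot be a proper one. *)
Lemma minimal_projection (P : 'M[R]_(dimv M)) :
  minimal_admissible M -> P *m P = P -> P != 0 ->
  (forall X Y, formv (P *m X) Y = formv X (P *m Y)) ->
  (forall Z, P *m J M Z = J M Z *m P) -> P = 1%:M.
Proof.
move=> [_ Mmin] PP P0 Psym PJ.
have [k [B [C [kP BC CB]]]] : exists k (B : 'M[R]_(dimv M, k)) (C : 'M[R]_(k, dimv M)),
    [/\ \rank P = k, B *m C = P & C *m B = 1%:M].
  exists (\rank P); have := row_base_free P; have := col_base_full P.
  have := mulmx_base P; move: (\rank P) (col_base P) (row_base P).
  move=> k B C BC Bfull Cfree; exists B, C; split=> //.
  apply: (row_free_inj Cfree); rewrite /= mul1mx.
  by apply: (row_full_inj Bfull); rewrite /= !mulmxA BC -mulmxA BC.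
have PB : P *m B = B by rewrite -BC -mulmxA CB mulmx1.
have CP : C *m P = C by rewrite -BC mulmxA CB mul1mx.
pose J' (Z : 'cV[R]_(r + s)) := C *m J M Z *m B.
have J'lin : linear J' by move=> a Z W; rewrite /J' linearP mulmxDr mulmxDl -scalemxAr -scalemxAl.
pose b x y := formv (B *m x) (B *m y).
have bP : scalar_product b.
  split=> [x y|a x y z|x H]; first by rewrite /b (sp_sym spv).
    by rewrite /b mulmxDr -scalemxAr !(spE spv).
  rewrite -[x]mul1mx -CB -mulmxA (_ : B *m x = 0) ?mulmx0 //.
  apply: (sp_nondeg spv) => Y; rewrite -PB -mulmxA Psym -BC -mulmxA.
  exact: H.
pose J'L : {linear 'cV[R]_(r + s) -> 'M[R]_k} :=
  HB.pack J' (GRing.isLinear.Build _ _ _ _ J' J'lin).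
have J'cl Z : J'L Z *m J'L Z = (- sp_rs Z Z)%:M.
  rewrite /= /J' !mulmxA -(mulmxA _ B C) BC -(mulmxA C) -PJ mulmxA CP.
  by rewrite -(mulmxA C) J_clifford mul_mx_scalar -scalemxAl CB scalemx1.
have J'skew Z : skew_mx b (J'L Z).
  move=> x y; rewrite /b /= /J' !mulmxA BC -!mulmxA Psym act_skew.
  by congr (- formv _ _); rewrite !mulmxA -PJ.
have /= rkP := Mmin (AdmissibleModule bP J'cl J'skew).
have {rkP} : (dimv M <= \rank P)%N by rewrite kP; apply: rkP; rewrite -kP lt0n mxrank_eq0.
move=> rkP; have Pu : P \in unitmx by rewrite -row_full_unit /row_full eqn_leq rank_leq_col.
by rewrite -[P](mulKmx Pu) PP mulVmx.
Qed.

End MinimalModules.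

Section ClosedExamples.
Variables (R : realType) (r s : nat) (M : admissible_module R r s).

Local Notation E k := (J M (delta_mx k 0)).

(** Commutators of distinct generators are twice their products. *)
Lemma closed_of_basis :
  (forall i j : 'I_(r + s), (i < j)%N -> exists V, E i *m E j = J M V) ->
  commutator_closed M.
Proof.
move=> H.
have {}H i j : exists V, E i *m E j - E j *m E i = J M V.
  have [ij|ji|/val_inj ->] := ltngtP i j.
  - have [V VE] := H _ _ ij; exists (2 *: V).
    by rewrite linearZ /= -VE [E j *m _]J_delta_anticomm ?opprK ?scaler_nat // gt_eqF.
  - have [V VE] := H _ _ ji; exists (- 2 *: V).
    rewrite linearZ /= -VE [E i *m _]J_delta_anticomm ?scaleNr ?scaler_nat -?opprD //.
    by rewrite gt_eqF.
  - by exists 0; rewrite subrr linear0.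
have [f fE] := choice (fun ij : 'I_(r + s) * 'I_(r + s) => H ij.1 ij.2).
move=> Z W; exists (\sum_i \sum_j (Z i 0 * W j 0) *: f (i, j)).
have JE (U : 'cV_(r + s)) : J M U = \sum_i U i 0 *: E i.
  rewrite {1}[U]matrix_sum_delta linear_sum; apply: eq_bigr => i _.
  by rewrite big_ord1 linearZ.
rewrite (JE Z) mulmx_suml mulmx_sumr -sumrB linear_sum; apply: eq_bigr => i _.
rewrite (JE W) mulmx_suml mulmx_sumr -sumrB linear_sum; apply: eq_bigr => j _.
rewrite [in RHS]linearZ /= -(fE (i, j)) /= -!scalemxAl -!scalemxAr scalerBr !scalerA.
by rewrite [W j 0 * _]mulrC.

Qed.

End ClosedExamples.

Lemma closed_01 (R : realType) (M : admissible_module R 0 1) : commutator_closed M.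
Proof. by apply: closed_of_basis => i j; rewrite !ord1. Qed.

(** The volume element [J_1 J_2 J_3] of the Clifford algebra is a central
    self-adjoint involution, hence a scalar on a minimal module; multiplying it
    by the third generator turns the product of two into the third. *)
Lemma closed_12 (R : realType) (M : admissible_module R 1 2) :
  minimal_admissible M -> commutator_closed M.
Proof.
move=> Mmin; pose a := J M (delta_mx (lshift 2 ord0) 0).
pose b := J M (delta_mx (rshift 1 ord0) 0).
pose c := J M (delta_mx (rshift 1 ord_max) 0).
have aa : a *m a = (-1)%:M by rewrite J_clifford sp_rs_lshift.
have bb : b *m b = 1%:M by rewrite J_clifford sp_rs_rshift opprK.
have cc : c *m c = 1%:M by rewrite J_clifford sp_rs_rshift opprK.
have ba : b *m a = - (a *m b) by exact: J_delta_anticomm.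
have ca : c *m a = - (a *m c) by exact: J_delta_anticomm.
have cb : c *m b = - (b *m c) by exact: J_delta_anticomm.
have aax k (x : 'M[R]_(dimv M, k)) : a *m (a *m x) = - x by rewrite mulmxA aa mul_scalar_mx scaleN1r.
have bbx k (x : 'M[R]_(dimv M, k)) : b *m (b *m x) = x by rewrite mulmxA bb mul1mx.
have ccx k (x : 'M[R]_(dimv M, k)) : c *m (c *m x) = x by rewrite mulmxA cc mul1mx.
have bax k (x : 'M[R]_(dimv M, k)) : b *m (a *m x) = - (a *m (b *m x)).
  by rewrite mulmxA ba mulNmx mulmxA.
have cax k (x : 'M[R]_(dimv M, k)) : c *m (a *m x) = - (a *m (c *m x)).
  by rewrite mulmxA ca mulNmx mulmxA.
have cbx k (x : 'M[R]_(dimv M, k)) : c *m (b *m x) = - (b *m (c *m x)).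
  by rewrite mulmxA cb mulNmx mulmxA.
have aN : a *m a = - 1%:M by rewrite aa raddfN.
(* The rules sort words in [a, b, c] up to sign, reducing squares. *)
pose ruleE := (mulmxN, opprK, aax, bbx, ccx, bax, cax, cbx, ba, ca, cb, aN, bb, cc, mulmx1).
pose w := a *m (b *m c).
have ww : w *m w = 1%:M by rewrite /w -!mulmxA !ruleE.
have wsym X Y : formv (w *m X) Y = formv X (w *m Y).
  by rewrite /w -!mulmxA !act_skew -/a -/b -/c !ruleE !(spE (formv_sp M)) ?opprK.
have wJ Z : w *m J M Z = J M Z *m w.
  have -> : Z = \sum_i Z i 0 *: delta_mx i 0.
    by rewrite [LHS]matrix_sum_delta; apply: eq_bigr => i _; rewrite big_ord1.
  rewrite linear_sum mulmx_suml mulmx_sumr; apply: eq_bigr => i _ /=.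
  rewrite linearZ /= -scalemxAl -scalemxAr; congr (_ *: _).
  case: (split_ordP i) => k ->; rewrite ?ord1 -/a /w; first by rewrite -!mulmxA !ruleE.
  have [->|->] : k = ord0 \/ k = ord_max.
    by case: k => [[|[|]]] // p; [left|right]; apply/val_inj.
  - by rewrite -/b -!mulmxA !ruleE.
  - by rewrite -/c -!mulmxA !ruleE.
have [e ee we] : exists2 e : R, e * e = 1 & w = e%:M.
  pose P := 2^-1 *: (1%:M + w).
  have wP : w = 2 *: P - 1%:M.
    by rewrite /P scalerA divff ?pnatr_eq0 // scale1r addrC addKr.
  have [P0|P0] := eqVneq P 0.
    by exists (-1); rewrite ?mulN1r ?opprK // wP P0 scaler0 sub0r raddfN.
  exists 1; rewrite ?mulr1 // wP (minimal_projection Mmin _ P0) //.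
  - by rewrite scaler_nat mulr2n addrK.
  - rewrite /P -scalemxAl -scalemxAr scalerA mulmxDl !mulmxDr !mul1mx ww mulmx1.
    rewrite [w + _]addrC -mulr2n -[X in _ *: X]scaler_nat scalerA; congr (_ *: _).
    by field.
  - move=> X Y; rewrite /P -!scalemxAl !mulmxDl !mul1mx !(spE (formv_sp M)).
    by rewrite wsym.
  - move=> Z; rewrite /P -scalemxAl -scalemxAr mulmxDl mulmxDr wJ.
    by rewrite mul1mx mulmx1.
have abE : a *m b = e *: c.
  by rewrite -[LHS]mulmx1 -cc mulmxA -(mulmxA a) -/w we mul_scalar_mx.
have acE : a *m c = - (e *: b).
  have : w *m b = e *: b by rewrite we mul_scalar_mx.
  by rewrite /w -!mulmxA !ruleE => <-; rewrite opprK.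
have bcE : b *m c = - (e *: a).
  have : a *m w = e *: a by rewrite we mul_mx_scalar.
  by rewrite /w !ruleE => <-; rewrite opprK.
apply: closed_of_basis => i j.
have idx (k : 'I_(1 + 2)) : [\/ k = lshift 2 ord0, k = rshift 1 ord0 | k = rshift 1 ord_max].
  by case: k => [[|[|[|]]]] // p; [apply: Or31|apply: Or32|apply: Or33]; apply/val_inj.
case: (idx i) => ->; case: (idx j) => -> // _.
- by exists (e *: delta_mx (rshift 1 ord_max) 0); rewrite linearZ.
- by exists (- e *: delta_mx (rshift 1 ord0) 0); rewrite linearZ /= scaleNr.
- by exists (- e *: delta_mx (lshift 2 ord0) 0); rewrite linearZ /= scaleNr.
Qed.

(** * Null eigenvectors obstruct the geodesic orbit property *)

Section DualSystems.
Variable R : realType.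

Definition dot n (x y : 'cV[R]_n) : R := (x^T *m y) 0 0.

Lemma dotE n (x y : 'cV[R]_n) : dot x y = \sum_i x i 0 * y i 0.
Proof. by rewrite /dot mxE; apply: eq_bigr => i _; rewrite mxE. Qed.

Lemma dotC n (x y : 'cV[R]_n) : dot x y = dot y x.
Proof. by rewrite !dotE; apply: eq_bigr => i _; rewrite mulrC. Qed.

Lemma dot_eq0 n (x : 'cV[R]_n) : dot x x = 0 -> x = 0.
Proof.
move=> x0; apply/colP => i; rewrite mxE; apply/eqP; rewrite -sqrf_eq0.
have /psumr_eq0P : forall i : 'I_n, true -> 0 <= x i 0 ^+ 2 by move=> j _; exact: sqr_ge0.
by move=> -> //; rewrite -[RHS]x0 dotE; apply: eq_bigr => j _; rewrite expr2.
Qed.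

(** Linear duality, in the form that turns an orthogonality argument into
    the existence of a solution. *)
Lemma solve_on_kernel m n p (G : 'M[R]_(m, n)) (A : 'M[R]_(p, n)) :
  (forall z : 'cV_p, (forall U : 'cV_n, G *m U = 0 -> dot z (A *m U) = 0) -> z = 0) ->
  forall y : 'cV_p, exists2 U : 'cV_n, G *m U = 0 & A *m U = y.
Proof.
move=> dual y; pose K := (kermx G^T)^T.
have GK : G *m K = 0.
  by apply: trmx_inj; rewrite trmx_mul trmxK mulmx_ker trmx0.
have /row_freeP[B KB] : row_free (A *m K).
  rewrite -kermx_eq0; apply/eqP/row_matrixP => i; rewrite row0.
  apply: trmx_inj; rewrite trmx0; apply: dual => U GU.
  have /submxP[D DU] : (U^T <= kermx G^T)%MS.
    by apply/sub_kermxP; rewrite -trmx_mul GU trmx0.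
  have -> : U = K *m D^T by rewrite -[U]trmxK DU trmx_mul.
  rewrite /dot trmxK (mulmxA A) (mulmxA (row _ _)) -row_mul mulmx_ker row0.
  by rewrite mul0mx mxE.
by exists (K *m (B *m y)); rewrite !mulmxA ?GK ?mul0mx // KB mul1mx.
Qed.

End DualSystems.

Section GeodesicOrbitAlgebra.
Variables (R : realType) (r s : nat) (M : admissible_module R r s).

(** The infinitesimal form of the geodesic orbit property; [k] accounts for
    the reparametrisation of the orbit. *)
Definition go_condition := forall Z (X : 'cV[R]_(dimv M)), exists D k,
  [/\ @in_lieH R r s M D, D.1 *m Z + k *: Z = 0 & D.2 *m X + k *: X = J M Z *m X].

End GeodesicOrbitAlgebra.

Section NullEigenvectors.
Variables (R : realType) (r s : nat) (M : admissible_module R r s).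
Implicit Types (U V Z : 'cV[R]_(r + s)) (X Y : 'cV[R]_(dimv M)).

Local Notation "Z ** X" := (J M Z *m X) (at level 41, right associativity).
Local Notation spz := (@sp_rsP R r s).

Hypothesis go : go_condition M.

(** Here [k = 0], as [C] is skew-symmetric and [Z] non-null. Since [J_e] maps
    [A X = J_Z X] to its opposite, while [A] commutes with [J_e] up to [J_(C e)], the
    vector [U = C e - 2 Z] annihilates [X]. *)
Lemma eigenvector_annihilator e Z X : e ** X = X ->
  sp_rs e Z = 0 -> sp_rs Z Z != 0 ->
  exists U, [/\ sp_rs U e = 0, U ** X = 0 & sp_rs U Z != 0].
Proof.
move=> eX eZ ZZ; have [D [k [Dh CZ AX]]] := go Z X.
have [Csk _ _] := Dh.
have k0 : k = 0.
  have := congr1 (sp_rs Z) CZ; have := Csk Z Z.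
  rewrite !(spE spz) (sp_sym spz (_ *m _)) => H1 H2.
  have /eqP : k * sp_rs Z Z = 0 by lra.
  by rewrite mulf_eq0 (negPf ZZ) orbF => /eqP.
move: CZ AX; rewrite {}k0 !scale0r !addr0 => CZ AX.
exists (D.1 *m e - 2 *: Z); split.
- have := Csk e e; rewrite !(spE spz) (sp_sym spz Z) eZ (sp_sym spz e (_ *m _)).
  lra.
- have := in_lieH_act e X Dh; rewrite eX AX act_anticomm eZ mulr0 scale0r subr0 eX.
  rewrite !actE; move: (Z ** X) (_ ** X) => x y /colP H.
  by apply/colP => i; have := H i; rewrite !mxE; lra.
have := Csk e Z; rewrite CZ !(spE spz) oppr0 => ->.
by rewrite sub0r oppr_eq0 mulf_neq0 ?pnatr_eq0.
Qed.

End NullEigenvectors.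

Section HyperbolicFrames.
Variables (R : realType) (r s : nat) (M : admissible_module R r s.+1).
Implicit Types (U V Z : 'cV[R]_(r + s.+1)) (X Y : 'cV[R]_(dimv M)).

Local Notation "Z ** X" := (J M Z *m X) (at level 41, right associativity).
Local Notation spz := (@sp_rsP R r s.+1).

Hypothesis go : go_condition M.

Let e : 'cV[R]_(r + s.+1) := delta_mx (rshift r ord0) 0.

(** In the language of spinors, [X] is a vacuum vector: it is killed by the
    annihilation operators [u i], and the [w i] are creation operators. *)
Record hyperbolic_frame X (u w : 'I_r -> 'cV[R]_(r + s.+1)) : Prop := HyperbolicFrame {
  frame_act : forall i, u i ** X = 0;
  frame_uu : forall i j, sp_rs (u i) (u j) = 0;
  frame_wu : forall i j, sp_rs (w i) (u j) = (i == j)%:R;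
  frame_ww : forall i j, sp_rs (w i) (w j) = 0;
  frame_eu : forall i, sp_rs e (u i) = 0;
  frame_ew : forall i, sp_rs e (w i) = 0;
  frame_span : forall U, sp_rs e U = 0 ->
    U = \sum_i (sp_rs (w i) U *: u i + sp_rs (u i) U *: w i) }.

(** Positive and negative coordinates in the orthogonal complement of [e]: the
    first negative coordinate, along [e], is left out. *)
Local Notation pos U := (usubmx U).
Local Notation neg U := (dsubmx (dsubmx U : 'cV[R]_(1 + s))).
Local Notation mk x y := (col_mx x (col_mx 0 y : 'cV[R]_(1 + s)) : 'cV[R]_(r + s.+1)).

Lemma sp_rs_e U : sp_rs e U = - U (rshift r ord0) 0.
Proof. by rewrite (sp_sym spz) sp_rs_delta sp_rs_rshift mulN1r. Qed.

Lemma mk_pos_neg U : sp_rs e U = 0 -> U = mk (pos U) (neg U).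
Proof.
rewrite sp_rs_e => U0; rewrite -[LHS]vsubmxK.
apply: (congr1 (@col_mx R r (1 + s) 1 (pos U))).
rewrite -[LHS](@vsubmxK _ 1 s); apply: (congr1 (@col_mx R 1 s 1 ^~ (neg U))).
apply/colP => i; rewrite !mxE ord1.
have -> : lshift s (0 : 'I_1) = ord0 by apply/val_inj.
by apply/eqP; rewrite -oppr_eq0 U0.
Qed.

Lemma sp_mk x y x' y' : sp_rs (mk x y) (mk x' y') = dot x x' - dot y y'.
Proof.
rewrite sp_rs_mx !col_mxKu !col_mxKd (@tr_col_mx _ 1 s) (@mul_row_col _ 1 1 s).
by rewrite trmx0 mul0mx add0r /dot !mxE.
Qed.

Lemma sp_e_mk x y : sp_rs e (mk x y) = 0.
Proof.
rewrite sp_rs_e col_mxEd; have -> : ord0 = lshift s (0 : 'I_1) by apply/val_inj.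
by rewrite (@col_mxEu _ 1 s) mxE oppr0.
Qed.

(** The annihilator of [X] in the orthogonal complement of [e] is totally
    null, and no non-null vector is orthogonal to it: it is a maximal totally null
    subspace, so the complement is a split space. *)
Lemma hyperbolic_frame_exists X : e ** X = X -> X != 0 ->
  r = s /\ exists u w, hyperbolic_frame X u w.
Proof.
move=> eX X0.
have dot0 n (x : 'cV[R]_n) : dot x 0 = 0 by rewrite /dot mulmx0 mxE.
have ann Z : sp_rs e Z = 0 ->
    (forall U, U ** X = 0 -> sp_rs e U = 0 -> sp_rs U Z = 0) -> sp_rs Z Z = 0.
  move=> eZ H; apply/eqP/negP => /negP /(eigenvector_annihilator go eX eZ).
  by case=> U [Ue UX /eqP]; rewrite H // (sp_sym spz).
have null U V : U ** X = 0 -> V ** X = 0 -> sp_rs U V = 0.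
  move=> UX VX; have := act_anticomm U V X.
  rewrite UX VX !act0r oppr0 sub0r => /esym/eqP.
  by rewrite oppr_eq0 scaler_eq0 (negPf X0) orbF mulf_eq0 pnatr_eq0 => /eqP.
pose G := col_mx (mx_of (fun U => U ** X)) (mx_of (fun U => (sp_rs e U)%:M : 'cV_1)).
have GE U : G *m U = col_mx (U ** X) (sp_rs e U)%:M.
  rewrite mul_col_mx !mx_ofE // => a x y; rewrite ?actE // !(spE spz).
  by rewrite scale_scalar_mx -raddfD.
have ker U : G *m U = 0 -> U ** X = 0 /\ sp_rs e U = 0.
  rewrite GE => /eqP; rewrite col_mx_eq0 => /andP[/eqP -> /eqP/matrixP/(_ 0 0)].
  by rewrite !mxE eqxx.
(* Otherwise some positive vector [mk z 0] is orthogonal to the annihilator. *)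
have pos_onto (y : 'cV_r) : exists U, [/\ U ** X = 0, sp_rs e U = 0 & pos U = y].
  have proj U : row_mx 1%:M 0 *m U = pos U.
    by rewrite -[U]vsubmxK mul_row_col mul1mx mul0mx addr0 col_mxKu.
  have [z zP|U /ker[UX eU]] := @solve_on_kernel R _ _ _ G (row_mx 1%:M 0) _ y.
    apply: dot_eq0; rewrite -[LHS]subr0 -[X in _ - X](dot0 s 0) -sp_mk.
    apply: ann (sp_e_mk _ _) _ => U UX eU.
    rewrite (mk_pos_neg eU) sp_mk dot0 subr0 dotC -proj.
    by apply: zP; rewrite GE UX eU raddf0 col_mx0.
  by rewrite proj => <-; exists U.
have [u uP] := choice (fun i : 'I_r => pos_onto (delta_mx i 0)).
have uX i : u i ** X = 0 by case: (uP i).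
have eu i : sp_rs e (u i) = 0 by case: (uP i).
have posu i : pos (u i) = delta_mx i 0 by case: (uP i).
have uu i j : sp_rs (u i) (u j) = 0 by exact: null.
(* The difference of the two sides is null without positive part. *)
have span U : U ** X = 0 -> sp_rs e U = 0 -> U = \sum_i pos U i 0 *: u i.
  move=> UX eU; apply/eqP; rewrite -subr_eq0; set V := _ - _.
  have VX : V ** X = 0.
    rewrite linearB linear_sum mulmxBl UX sub0r mulmx_suml big1 ?oppr0 // => i _.
    by rewrite linearZ /= -scalemxAl uX scaler0.
  have eV : sp_rs e V = 0.
    rewrite !(spE spz) eU sub0r (sp_sumr spz) big1 ?oppr0 // => i _.
    by rewrite !(spE spz) eu mulr0.
  have posV : pos V = 0.
    apply/colP => i; rewrite linearB linear_sum !mxE summxE (bigD1 i) //= big1.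
      by rewrite linearZ /= posu !mxE !eqxx mulr1 addr0 subrr.
    by move=> j ji; rewrite linearZ /= posu !mxE eq_sym (negPf ji) mulr0.
  have := null _ _ VX VX; rewrite (mk_pos_neg eV) posV sp_mk dot0 sub0r.
  by move=> /eqP; rewrite oppr_eq0 => /eqP/dot_eq0 ->; rewrite !col_mx0.
pose F := \matrix_(i, j) neg (u i) j 0.
have FE i z : (F *m z) i 0 = dot (neg (u i)) z.
  by rewrite dotE mxE; apply: eq_bigr => j _; rewrite mxE.
(* The [u i] are null with orthonormal positive parts. *)
have FF : F *m F^T = 1%:M.
  apply/matrixP => i j; have := uu i j.
  rewrite (mk_pos_neg (eu i)) (mk_pos_neg (eu j)) sp_mk !posu => /eqP.
  rewrite subr_eq0 => /eqP H; rewrite mxE [RHS]mxE.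
  transitivity (dot (neg (u i)) (neg (u j))).
    by rewrite dotE; apply: eq_bigr => k _; rewrite !mxE.
  rewrite -H dotE (bigD1 i) //= !mxE !eqxx mul1r big1 ?addr0 ?andbT //.
  by move=> k ki; rewrite !mxE (negPf ki) mul0r.
(* Otherwise the negative vector [mk 0 z] is orthogonal to the annihilator. *)
have Fker (z : 'cV_s) : F *m z = 0 -> z = 0.
  move=> Fz; apply: dot_eq0; apply/eqP; rewrite -oppr_eq0 -sub0r -[X in X - _](dot0 r 0) -sp_mk.
  apply/eqP; apply: ann (sp_e_mk _ _) _ => U UX eU.
  rewrite (span _ UX eU) (sp_suml spz) big1 // => i _.
  by rewrite (spE spz) (mk_pos_neg (eu i)) sp_mk dot0 sub0r -FE Fz [X in - X]mxE oppr0 mulr0.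
have rs : r = s.
  apply/eqP; rewrite eqn_leq (mulmx1_min FF) /=.
  have /row_freeP[B FB] : row_free F^T.
    rewrite -kermx_eq0; apply/eqP/row_matrixP => i; rewrite row0.
    apply: trmx_inj; rewrite trmx0; apply: Fker; rewrite -[F]trmxK -trmx_mul.
    by rewrite trmxK -row_mul mulmx_ker row0 trmx0.
  exact: mulmx1_min FB.
(* Half the difference of the positive and negative parts of [u i]. *)
have [w wE] : exists w, forall i, w i = mk (delta_mx i 0) 0 - 2^-1 *: u i.
  by exists (fun i => mk (delta_mx i 0) 0 - 2^-1 *: u i).
have mku i j : sp_rs (mk (delta_mx i 0) 0) (u j) = (i == j)%:R.
  rewrite (mk_pos_neg (eu j)) sp_mk posu [dot 0 _]dotC dot0 subr0 dotE.
  rewrite (bigD1 i) //= !mxE !eqxx mul1r big1 ?addr0 ?andbT //.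
  by move=> k ki; rewrite !mxE (negPf ki) mul0r.
have wu i j : sp_rs (w i) (u j) = (i == j)%:R.
  by rewrite wE !(spE spz) mku uu; lra.
have ew i : sp_rs e (w i) = 0 by rewrite wE !(spE spz) sp_e_mk eu mulr0 subr0.
have ww i j : sp_rs (w i) (w j) = 0.
  rewrite [w j]wE !(spE spz) wu wE !(spE spz) (sp_sym spz (u i) (mk _ _)) mku sp_mk dot0.
  rewrite dotE (bigD1 i) //= !mxE !eqxx mul1r big1 ?andbT.
    by rewrite [j == i]eq_sym; lra.
  by move=> k ki; rewrite !mxE (negPf ki) mul0r.
split=> //; exists u, w; split=> // U eU.
apply/eqP; rewrite -subr_eq0; set V := _ - _.
have eV : sp_rs e V = 0.
  rewrite !(spE spz) eU sub0r (sp_sumr spz) big1 ?oppr0 // => i _.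
  by rewrite !(spE spz) eu ew !mulr0 addr0.
have uV i : sp_rs (u i) V = 0.
  rewrite !(spE spz) (sp_sumr spz) (bigD1 i) //= big1 => [|j ji].
    by rewrite !(spE spz) uu (sp_sym spz (u i) (w i)) wu eqxx /=; lra.
  by rewrite !(spE spz) uu (sp_sym spz (u i) (w j)) wu (negPf ji) !mulr0 addr0.
have wV i : sp_rs (w i) V = 0.
  rewrite !(spE spz) (sp_sumr spz) (bigD1 i) //= big1 => [|j ji].
    by rewrite !(spE spz) ww wu eqxx /=; lra.
  by rewrite !(spE spz) ww wu eq_sym (negPf ji) !mulr0 addr0.
have posV : pos V = 0.
  apply/colP => i; rewrite [RHS]mxE; have := wV i.
  rewrite wE (spDl spz) (spNl spz) (spZl spz) uV mulr0 subr0 (mk_pos_neg eV) sp_mk [dot 0 _]dotC dot0 subr0 dotC.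
  rewrite col_mxKu dotE (bigD1 i) //= big1 => [|j ji].
    by rewrite [delta_mx _ _ _ _]mxE !eqxx mulr1 addr0.
  by rewrite [delta_mx _ _ _ _]mxE (negPf ji) mulr0.
rewrite (mk_pos_neg eV) posV (Fker (neg V)) ?col_mx0 //.
apply/colP => i; rewrite FE mxE; have := uV i.
rewrite (mk_pos_neg (eu i)) (mk_pos_neg eV) sp_mk posV dot0 sub0r => /eqP.
by rewrite oppr_eq0 !col_mxKd => /eqP.
Qed.

End HyperbolicFrames.

Section SmallFrames.
Variables (R : realType) (r s : nat) (M : admissible_module R r s.+1).
Implicit Types (U V Z : 'cV[R]_(r + s.+1)) (X Y : 'cV[R]_(dimv M)).

Local Notation "Z ** X" := (J M Z *m X) (at level 41, right associativity).
Local Notation spv := (formv_sp M).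
Local Notation spz := (@sp_rsP R r s.+1).

Hypothesis go : go_condition M.

Let e : 'cV[R]_(r + s.+1) := delta_mx (rshift r ord0) 0.

Variables (X : 'cV[R]_(dimv M)) (u w : 'I_r -> 'cV[R]_(r + s.+1)).
Hypothesis X0 : X != 0.
Hypothesis frame : hyperbolic_frame X u w.

Let uX i : u i ** X = 0. Proof. exact: frame_act frame i. Qed.

Let uw i Y : u i ** w i ** Y = - (w i ** u i ** Y) - 2 *: Y.
Proof. by rewrite act_anticomm (sp_sym spz) (frame_wu frame) eqxx mulr1. Qed.

Let uw_neq i j Y : i != j -> u i ** w j ** Y = - (w j ** u i ** Y).
Proof.
move=> ij; rewrite act_anticomm (sp_sym spz) (frame_wu frame) eq_sym (negPf ij).
by rewrite mulr0 scale0r subr0.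
Qed.

Let ww i Y : w i ** w i ** Y = 0.
Proof. by rewrite act_sq (frame_ww frame) oppr0 scale0r. Qed.

Let ww_neq i j Y : w i ** w j ** Y = - (w j ** w i ** Y).
Proof. by rewrite act_anticomm (frame_ww frame) mulr0 scale0r subr0. Qed.

Let uu i Y : u i ** u i ** Y = 0.
Proof. by rewrite act_sq (frame_uu frame) oppr0 scale0r. Qed.

Let uu_neq i j Y : u i ** u j ** Y = - (u j ** u i ** Y).
Proof. by rewrite act_anticomm (frame_uu frame) mulr0 scale0r subr0. Qed.

Let ew i Y : e ** w i ** Y = - (w i ** e ** Y).
Proof. by rewrite act_anticomm (frame_ew frame) mulr0 scale0r subr0. Qed.

Let eu i Y : e ** u i ** Y = - (u i ** e ** Y).
Proof. by rewrite act_anticomm (frame_eu frame) mulr0 scale0r subr0. Qed.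

Let norm_uw i : sp_rs (u i + w i) (u i + w i) != 0.
Proof.
rewrite !(spE spz) (frame_uu frame) (frame_ww frame) (sp_sym spz (u i)).
by rewrite (frame_wu frame) eqxx add0r addr0 -mulr2n pnatr_eq0.
Qed.

(** It suffices to exhibit an eigenvector whose annihilator is orthogonal to the
    hyperbolic plane spanned by some [u i] and [w i]. *)
Let contra_plane i Y : e ** Y = Y ->
  (forall U, sp_rs e U = 0 -> U ** Y = 0 -> sp_rs (u i) U = 0 /\ sp_rs (w i) U = 0) ->
  False.
Proof.
move=> eY H; have ez : sp_rs e (u i + w i) = 0.
  by rewrite (spE spz) (frame_eu frame) (frame_ew frame) addr0.
have [U [Ue UY /eqP]] := eigenvector_annihilator go eY ez (norm_uw i).
rewrite (sp_sym spz) in Ue; have [uU wU] := H U Ue UY.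
by rewrite (sp_sym spz) (spE spz) uU wU addr0.
Qed.

(** Applying [w i], [u i], [u j], [u k], [u l] in turn isolates the coefficient
    of [u i] in [U], and then that of [w j]. *)
Let four_fold i j k l U : uniq [:: i; j; k; l] ->
  U ** (X + w i ** w j ** w k ** w l ** X) = 0 ->
  sp_rs (w i) U = 0 /\ sp_rs (u j) U = 0.
Proof.
rewrite /= !inE !negb_or => /and4P[/and3P[ij ik il] /andP[jk jl] kl _].
have [Y YE] : exists Y, Y = w i ** w j ** w k ** w l ** X by eexists.
rewrite -YE actDr => UX.
have wY : w i ** Y = 0 by rewrite YE ww.
have S1 : U ** w i ** X = - (2 * sp_rs (w i) U) *: (X + Y).
  have := congr1 (mulmx (J M (w i))) UX.
  rewrite actDr (act_anticomm (w i) U X) (act_anticomm (w i) U Y) wY !act0r oppr0 sub0r.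
  move: (U ** _) => V /colP H; apply/colP => m; have := H m; rewrite !mxE; lra.
have uwX a : u a ** w a ** X = - 2 *: X by rewrite uw uX act0r oppr0 sub0r scaleNr.
have uwX' a b : a != b -> u a ** w b ** X = 0.
  by move=> ab; rewrite uw_neq // uX act0r oppr0.
have S2 : U ** X = sp_rs (u i) U *: (w i ** X) + (2 * sp_rs (w i) U) *: (w j ** w k ** w l ** X).
  have := congr1 (mulmx (J M (u i))) S1.
  rewrite act_anticomm uwX !actZr actDr uX add0r YE uw !uw_neq // uX !(act0r, oppr0) ?sub0r.
  move: (U ** X) (w i ** X) (w j ** _) => V V' V'' /colP H; apply/colP => m.
  by have := H m; rewrite !mxE; lra.
have S3 : sp_rs (u j) U *: X = (2 * sp_rs (w i) U) *: (w k ** w l ** X).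
  have := congr1 (mulmx (J M (u j))) S2.
  rewrite act_anticomm uX act0r oppr0 sub0r actDr !actZr uwX' 1?eq_sym // uw.
  rewrite !uw_neq // uX !(act0r, oppr0, scaler0) ?sub0r ?add0r.
  move: (w k ** _) => V /colP H; apply/colP => m; have := H m; rewrite !mxE; lra.
have a0 : sp_rs (w i) U = 0.
  have := congr1 (mulmx (J M (u l))) (congr1 (mulmx (J M (u k))) S3).
  rewrite !actZr uX act0r scaler0 uw uw_neq // uX !(act0r, oppr0) sub0r actNr actZr uwX.
  rewrite !(scaleNr, scalerN) !scalerA => /esym/eqP.
  rewrite ?oppr_eq0 scaler_eq0 (negPf X0) orbF !mulf_eq0 !pnatr_eq0.
  by case/orP => [/orP[/eqP|]|].
split=> //; move: S3; rewrite a0 mulr0 scale0r => /eqP.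
by rewrite scaler_eq0 (negPf X0) orbF => /eqP.
Qed.

(** The sum of the vacuum and of a state with four creation operators is not
    pure: its annihilator is too small. The even number of creation operators
    keeps it in the eigenspace of [J_e]. *)
Lemma frame_lt4 : e ** X = X -> (r < 4)%N.
Proof.
move=> eX; rewrite ltnNge; apply/negP => r4.
have lt4 m : (m < 4)%N -> (m < r)%N by move=> /leq_trans; apply.
pose i m (h : (m < 4)%N) : 'I_r := Ordinal (lt4 m h).
pose i0 := i 0 isT; pose i1 := i 1 isT; pose i2 := i 2 isT; pose i3 := i 3 isT.
have eY : e ** (X + w i0 ** w i1 ** w i2 ** w i3 ** X) =
    X + w i0 ** w i1 ** w i2 ** w i3 ** X.
  by rewrite actDr !ew eX !mulmxN !opprK.
apply: (@contra_plane i0 _ eY) => U _ UY; split.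
  (* A cyclic permutation of three creation operators is even. *)
  have := @four_fold i2 i0 i1 i3 U isT; rewrite [w i2 ** _]ww_neq.
  by rewrite [w i2 ** w i1 ** _]ww_neq mulmxN opprK => /(_ UY)[].
by have [] := @four_fold i0 i1 i2 i3 U isT UY.
Qed.

(** The form pairs [X] with the opposite eigenspace of [J_e]. An even number of
    annihilation operators preserves this eigenspace, and here two of them
    suffice to produce a second vacuum [V] in it; then [X + w i V] is not pure. *)
Lemma frame_neq2 : e ** X = X -> r <> 2.
Proof.
move=> eX r2; pose i : 'I_r := cast_ord (esym r2) ord0; pose j : 'I_r := cast_ord (esym r2) ord_max.
have ij : i != j by [].
have sum2 (F : 'I_r -> 'cV[R]_(r + s.+1)) : \sum_k F k = F i + F j.
  rewrite (bigD1 i) //= (bigD1 j) 1?eq_sym //= big1 ?addr0 // => k /andP[ki kj].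
  have : (k < 2)%N by apply: leq_trans (ltn_ord k) _; rewrite r2.
  by move: ki kj; rewrite -!(inj_eq val_inj) /=; case: (val k) => [|[]].
have [Y XY] := sp_neq0 spv X0.
pose V := u i ** u j ** (Y - e ** Y).
have uV : u i ** V = 0 /\ u j ** V = 0.
  by rewrite /V [u j ** u i ** _]uu_neq !uu act0r oppr0.
have ee X' : e ** e ** X' = X' by rewrite act_sq sp_rs_rshift opprK scale1r.
have eV : e ** V = - V.
  by rewrite /V !eu mulmxN opprK mulmxBr ee -opprB !mulmxN.
have V0 : V != 0.
  apply: contraNneq XY => V0.
  have : formv (w i ** w j ** X) V = 0 by rewrite V0 (sp0r spv).
  have uuww : u j ** u i ** w i ** w j ** X = 4 *: X.
    rewrite uw (uw_neq _ ij) uX !(act0r, oppr0) sub0r actNr actZr uw uX act0r oppr0.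
    by rewrite sub0r scalerN opprK scalerA; congr (_ *: _); ring.
  have := act_skew (u j) (u i ** w i ** w j ** X) (Y - e ** Y).
  have := act_skew (u i) (w i ** w j ** X) (u j ** (Y - e ** Y)).
  rewrite uuww /V !(spE spv) => H1 H2 H3; apply/eqP.
  have := act_skew e X Y; rewrite eX; lra.
have eX' : e ** (X + w i ** V) = X + w i ** V.
  by rewrite actDr eX ew eV mulmxN opprK.
clearbody V; case: uV => uiV ujV.
apply: (contra_plane (i := i) eX') => U eU; rewrite {1}(frame_span frame eU) sum2.
move: (sp_rs (w i) U) (sp_rs (u i) U) (sp_rs (w j) U) (sp_rs (u j) U) => ai bi aj bj.
have uwX k : u k ** w k ** X = - 2 *: X by rewrite uw uX act0r oppr0 sub0r scaleNr.
have uwV k : u k ** V = 0 -> u k ** w k ** V = - 2 *: V.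
  by move=> ukV; rewrite uw ukV act0r oppr0 sub0r scaleNr.
have ujwi (x : 'cV_(dimv M)) : u j ** x = 0 -> u j ** w i ** x = 0.
  by move=> ujx; rewrite uw_neq 1?eq_sym // ujx act0r oppr0.
have uiwj (x : 'cV_(dimv M)) : u i ** x = 0 -> u i ** w j ** x = 0.
  by move=> uix; rewrite uw_neq // uix act0r oppr0.
rewrite !(actDl, actZl, actDr) !uX ww (uwV _ uiV) (ujwi V) // !(scaler0, add0r, addr0).
move=> H.
have uuwX : u j ** w j ** w i ** V = - 2 *: (w i ** V).
  by rewrite uw (ujwi V) // act0r oppr0 sub0r scaleNr.
have zero (c : R) (x : 'cV_(dimv M)) : x != 0 -> c *: x = 0 -> c = 0.
  by move=> x0 /eqP; rewrite scaler_eq0 (negPf x0) orbF => /eqP.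
have bj0 : bj = 0.
  have := congr1 (mulmx (J M (u i))) (congr1 (mulmx (J M (u j))) H).
  rewrite !(actDr, actZr) (ujwi X) ?uX // ujV uwX uuwX !(actDr, actZr, uX, act0r).
  rewrite (uwV i) // !(scaler0, add0r) !scalerA => /(zero _ _ V0); lra.
move: H; rewrite bj0 !scale0r !addr0 => H.
have bi0 : bi = 0.
  have := congr1 (mulmx (J M (u i))) H.
  by rewrite !(actDr, actZr) uiV uwX act0r !scaler0 addr0 scalerA => /(zero _ _ X0); lra.
split=> //; move: H; rewrite bi0 scale0r add0r scalerA => /(zero _ _ V0); lra.
Qed.

End SmallFrames.

Section SplitSignatures.
Variables (R : realType) (r s : nat) (M : admissible_module R r s).


(** If the centre has dimension at least two, a generator [J_e] with
    [J_e ^ 2 = 1] anticommutes with an invertible one, hence has the eigenvalue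
    [1]; a frame for an eigenvector [X] gives [r = s - 1], [r < 4] and [r <> 2]. *)
Lemma go_signature : (0 < dimv M)%N -> (1 <= s)%N -> go_condition M ->
  [\/ (r, s) = (0, 1)%N, (r, s) = (1, 2)%N | (r, s) = (3, 4)%N].
Proof.
case: s M => // s' M' d0 _ go; have [r0|rs] := leqP (r + s'.+1) 1.
  by apply: Or31; congr (_, _); lia.
pose e : 'cV[R]_(r + s'.+1) := delta_mx (rshift r ord0) 0.
have ee (x : 'cV_(dimv M')) : J M' e *m (J M' e *m x) = x.
  by rewrite act_sq sp_rs_rshift opprK scale1r.
have [X eX X0] : exists2 X : 'cV_(dimv M'), J M' e *m X = X & X != 0.
  have Y0 : (const_mx 1 : 'cV[R]_(dimv M')) != 0.
    apply/eqP => /matrixP/(_ (Ordinal d0) 0); rewrite !mxE => /eqP.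
    by rewrite oner_eq0.
  move: (const_mx 1) Y0 => Y Y0.
  have [|YY] := eqVneq (Y + J M' e *m Y) 0; last first.
    by exists (Y + J M' e *m Y); rewrite // mulmxDr ee addrC.
  move=> /eqP; rewrite addrC addr_eq0 => /eqP eY.
  have [k ke] := other_index (rshift r ord0 : 'I_(r + s'.+1)) rs.
  exists (J M' (delta_mx k 0) *m Y).
    rewrite act_anticomm sp_rs_perp 1?eq_sym // mulr0 scale0r subr0 eY.
    by rewrite mulmxN opprK.
  by apply: contraNneq Y0 => /act_eq0 -> //; exact: sp_rs_unit.
have [rs' [u [w frame]]] := hyperbolic_frame_exists go eX X0.
have := frame_lt4 go X0 frame eX; have := frame_neq2 go X0 frame eX.
move: rs; rewrite -{}rs'.
case: (r) => [|[|[|[|]]]] //= _ _ _; first by apply: Or32.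
by apply: Or33.
Qed.

End SplitSignatures.

(** * Signature (3, 4) *)

Section Doubling.
Variables (R : realType) (n : nat).
Implicit Types (A S : 'M[R]_n) (p q : R).

(** One step of the periodicity from signature (r, s) to (r + 1, s + 1): the
    coordinates along the two new directions are [(p - q) / 2] and [(p + q) / 2]. *)
Definition double A p q : 'M[R]_(n + n) := block_mx A p%:M q%:M (- A).

Lemma double_linear a A p q A' p' q' :
  double (a *: A + A') (a * p + p') (a * q + q') = a *: double A p q + double A' p' q'.
Proof.
rewrite /double scale_block_mx add_block_mx !scale_scalar_mx -!raddfD /=.
by rewrite scalerN -opprD.
Qed.

Lemma double_sq A p q c : A *m A = c%:M -> double A p q *m double A p q = (c + p * q)%:M.
Proof.
move=> AA; rewrite /double mulmx_block mulNmx mulmxN !mulmxN !mulNmx opprK AA.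
rewrite !mul_scalar_mx !mul_mx_scalar !scale_scalar_mx -!raddfD /= subrr subrr.
by rewrite [q * p]mulrC [p * q + c]addrC -scalar_mx_block.
Qed.

Lemma double_skew A S p q : A^T *m S = S *m A ->
  (double A p q)^T *m block_mx 0 S (- S) 0 = - (block_mx 0 S (- S) 0 *m double A p q).
Proof.
move=> AS; rewrite /double tr_block_mx !tr_scalar_mx !mulmx_block opp_block_mx.
rewrite !mulmx0 !mul0mx !(addr0, add0r) [(- A)^T]raddfN /= !(mulNmx, mulmxN) !opprK AS.
by rewrite !mul_scalar_mx !mul_mx_scalar.
Qed.

Lemma double_sym A S p q : A^T *m S = - (S *m A) ->
  (double A p q)^T *m block_mx 0 S S 0 = block_mx 0 S S 0 *m double A p q.
Proof.
move=> AS; rewrite /double tr_block_mx !tr_scalar_mx !mulmx_block.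
rewrite !mulmx0 !mul0mx !(addr0, add0r) [(- A)^T]raddfN /= !(mulNmx, mulmxN) AS opprK.
by rewrite !mul_scalar_mx !mul_mx_scalar.
Qed.

End Doubling.

Section SplitModule.
Variable R : realType.

(** Three doublings of the module of dimension one of signature (0, 1); every
    doubling adds a positive and a negative direction. *)
Definition triple_double (x y : nat -> R) : 'M[R]_(1 + 1 + (1 + 1) + (1 + 1 + (1 + 1))) :=
  double (double (double (y 3)%:M (y 0 + x 0) (y 0 - x 0)) (y 1 + x 1) (y 1 - x 1))
    (y 2 + x 2) (y 2 - x 2).

Lemma triple_double_linear a (x y x' y' : nat -> R) :
  triple_double (fun i => a * x i + x' i) (fun i => a * y i + y' i)
  = a *: triple_double x y + triple_double x' y'.
Proof.
rewrite /triple_double -!double_linear scale_scalar_mx -raddfD /=.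
have addE b c b' c' : a * b + b' + (a * c + c') = a * (b + c) + (b' + c') by ring.
have subE b c b' c' : a * b + b' - (a * c + c') = a * (b - c) + (b' - c') by ring.
by rewrite !addE !subE.
Qed.

Definition J34 (Z : 'cV[R]_(3 + 4)) :=
  triple_double (fun i => Z (lshift 4 (inord i)) 0) (fun i => Z (rshift 3 (inord i)) 0).

Lemma J34_linear : linear J34.
Proof.
move=> a Z W; rewrite /J34 -triple_double_linear.
have shift k (f : 'I_k.+1 -> 'I_(3 + 4)) : (fun i => (a *: Z + W) (f (inord i)) 0)
    = fun i => a * Z (f (inord i)) 0 + W (f (inord i)) 0.
  by apply: funext => i; rewrite !mxE.
by rewrite (shift 2 (@lshift 3 4)) (shift 3 (@rshift 3 4)).
Qed.

(** A doubling exchanges, with respect to the form, skew-symmetric and symmetric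
    Clifford actions; the skew factor is used twice and the symmetric one once, so
    that the resulting form is symmetric. *)
Definition gram34 : 'M[R]_(1 + 1 + (1 + 1) + (1 + 1 + (1 + 1))) :=
  let S1 : 'M[R]_1 := 1%:M in
  let S2 : 'M[R]_(1 + 1) := block_mx 0 S1 (- S1) 0 in
  let S3 : 'M[R]_(1 + 1 + (1 + 1)) := block_mx 0 S2 S2 0 in
  block_mx 0 S3 (- S3) 0.

Lemma gram34_sym : gram34^T = gram34.
Proof.
have tN m n (A : 'M[R]_(m, n)) : (- A)^T = - A^T by rewrite raddfN.
by rewrite /gram34 !(tr_block_mx, trmx0, tN, trmx1) !(opp_block_mx, oppr0, opprK).
Qed.

Lemma gram34_sq : gram34 *m gram34 = 1%:M.
Proof.
rewrite /gram34 !(mulmx_block, mulmx0, mul0mx, mulNmx, mulmxN, addr0, add0r, oppr0, mulmx1).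
rewrite !(opp_block_mx, opprK, oppr0).
by rewrite -!scalar_mx_block.
Qed.

Lemma J34_skew Z : (J34 Z)^T *m gram34 = - (gram34 *m J34 Z).
Proof.
apply: double_skew; apply: double_sym; apply: double_skew.
by rewrite tr_scalar_mx mulmx1 mul1mx.
Qed.

Lemma sum_ord3 (f : 'I_3 -> R) : \sum_i f i = f (inord 0) + f (inord 1) + f (inord 2).
Proof.
rewrite !big_ord_recr big_ord0 /= add0r; congr (f _ + f _ + f _);
  by apply/val_inj; rewrite /= inordK.
Qed.

Lemma sum_ord4 (f : 'I_4 -> R) :
  \sum_i f i = f (inord 0) + f (inord 1) + f (inord 2) + f (inord 3).
Proof.
rewrite !big_ord_recr big_ord0 /= add0r; congr (f _ + f _ + f _ + f _);
  by apply/val_inj; rewrite /= inordK.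
Qed.

Lemma J34_clifford Z : J34 Z *m J34 Z = (- sp_rs Z Z)%:M.
Proof.
have sq (t : R) : (t%:M : 'M[R]_1) *m t%:M = (t * t)%:M by rewrite scalar_mxM.
rewrite /J34 /triple_double (double_sq _ _ (double_sq _ _ (double_sq _ _ (sq _)))).
congr (_%:M); rewrite /sp_rs sum_ord3 sum_ord4; ring.
Qed.

Definition form34 (x y : 'cV[R]_(1 + 1 + (1 + 1) + (1 + 1 + (1 + 1)))) : R :=
  (x^T *m gram34 *m y) 0 0.

Lemma form34_sp : scalar_product form34.
Proof.
split=> [x y|a x y z|x H].
- transitivity ((x^T *m gram34 *m y)^T 0 0); first by rewrite [RHS]mxE.
  by rewrite !trmx_mul trmxK gram34_sym mulmxA.
- by rewrite /form34 linearP /= !mulmxDl -!scalemxAl !mxE.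
have : x^T *m gram34 = 0.
  apply/rowP => i; have := H (delta_mx i 0).
  by rewrite /form34 -colE !mxE => ->.
move=> /(congr1 (mulmx^~ gram34)); rewrite /= -mulmxA gram34_sq mulmx1 mul0mx.
by move=> x0; rewrite -[x]trmxK x0 trmx0.
Qed.

Lemma J34_form_skew Z : skew_mx form34 (J34 Z).
Proof.
move=> x y; rewrite /form34 trmx_mul -(mulmxA x^T) J34_skew mulmxN mulNmx.
by rewrite !mulmxA mxE.
Qed.

HB.instance Definition _ := GRing.isLinear.Build R _ _ _ J34 J34_linear.

Definition module34 : admissible_module R 3 4 :=
  AdmissibleModule form34_sp J34_clifford J34_form_skew.

Lemma minimal34_dim (M : admissible_module R 3 4) : minimal_admissible M -> (dimv M <= 8)%N.
Proof. by case=> _ /(_ module34); apply. Qed.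

End SplitModule.

Section Spin.
Variables (R : realType) (r s : nat) (M : admissible_module R r s).
Implicit Types (U V Z W Q : 'cV[R]_(r + s)) (X Y : 'cV[R]_(dimv M)).

Local Notation "Z ** X" := (J M Z *m X) (at level 41, right associativity).
Local Notation spv := (formv_sp M).
Local Notation spz := (@sp_rsP R r s).

(** The element of [so(z)] rotating the plane of [U] and [V], with its action on
    spinors; the scalar removes the symmetric part of [J_U J_V]. *)
Definition spin U V : 'M[R]_(r + s) * 'M[R]_(dimv M) :=
  (mx_of (fun Q => 2 *: (sp_rs U Q *: V - sp_rs V Q *: U)),
   J M U *m J M V + (sp_rs U V)%:M).

Lemma spin1E U V Q : (spin U V).1 *m Q = 2 *: (sp_rs U Q *: V - sp_rs V Q *: U).
Proof.
rewrite mx_ofE // => a x y; rewrite !(spE spz).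
by apply/colP => i; rewrite !mxE; ring.
Qed.

Lemma spin2E U V X : (spin U V).2 *m X = U ** V ** X + sp_rs U V *: X.
Proof. by rewrite mulmxDl mul_scalar_mx -mulmxA. Qed.

Lemma in_lieH_spin U V : in_lieH (spin U V).
Proof.
split=> [x y|x y|Q].
- rewrite !spin1E !(spE spz) (sp_sym spz x V) (sp_sym spz x U); ring.
- rewrite !spin2E !(spE spv) !act_skew act_anticomm !(spE spv) (sp_sym spz V U).
  by lra.
apply: mx_ext => X; rewrite mulmxBl -!mulmxA spin1E !spin2E.
rewrite actDr actZr (act_anticomm Q U) (act_anticomm Q V) !actE.
rewrite (sp_sym spz Q U) (sp_sym spz Q V).
move: (U ** V ** Q ** X) (U ** X) (V ** X) (Q ** X) => x1 x2 x3 x4.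
by apply/colP => i; rewrite !mxE; ring.
Qed.

End Spin.

(** The Fredholm alternative for a finite family of vectors. *)
Lemma combination_of_annihilators (F : fieldType) (T : finType) n
    (g : T -> 'rV[F]_n) (v : 'rV[F]_n) :
  (forall y : 'cV_n, (forall t, g t *m y = 0) -> v *m y = 0) ->
  exists c : T -> F, v = \sum_t c t *: g t.
Proof.
move=> H; pose G := \matrix_(k < #|T|) g (enum_val k).
have /submxP[D ->] : (v <= G)%MS.
  rewrite submxE; apply/eqP/matrixP => i j; rewrite ord1 [RHS]mxE.
  have : v *m col j (cokermx G) = 0.
    apply: H => t; have := congr1 (row (enum_rank t)) (mulmx_coker G).
    rewrite row_mul rowK enum_rankK row0 colE mulmxA => ->.
    by rewrite mul0mx.
  by move/matrixP/(_ 0 0); rewrite colE mulmxA -colE !mxE.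
exists (fun t => D 0 (enum_rank t)); rewrite mulmx_sum_row.
rewrite [RHS](reindex (@enum_val T T)) /=; last exact: onW_bij (@enum_val_bij T).
by apply: eq_bigr => k _; rewrite rowK enum_valK.
Qed.

Lemma linear_basis0 (R : realType) n (f : 'cV[R]_n -> R) :
  (forall a x y, f (a *: x + y) = a * f x + f y) ->
  (forall i, f (delta_mx i 0) = 0) -> forall x, f x = 0.
Proof.
move=> fP f0 x; have f00 : f 0 = 0 by have := fP (-1) 0 0; rewrite scaler0 addr0; lra.
have -> : x = \sum_i x i 0 *: delta_mx i 0.
  by rewrite [LHS]matrix_sum_delta; apply: eq_bigr => i _; rewrite big_ord1.
by elim/big_rec: _ => // i y _ yf; rewrite fP f0 mulr0 add0r.
Qed.

Section SplitOctonions.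
Variables (R : realType) (r s : nat) (M : admissible_module R r s).
Implicit Types (U V Z W Q : 'cV[R]_(r + s)) (X Y N : 'cV[R]_(dimv M)).

Local Notation "Z ** X" := (J M Z *m X) (at level 41, right associativity).
Local Notation spv := (formv_sp M).
Local Notation spz := (@sp_rsP R r s).

Hypothesis dim_le : (dimv M <= (r + s).+1)%N.

(** For [v] the split octonions, the vanishing of the defect is a form of the
    alternative law: [J_([X, Y]) X] is [<X, X>] times the projection of [Y] off
    [X]. *)
Let defect X Y := bracket_v X Y ** X - formv X X *: Y + formv X Y *: X.

(** A non-null [X] and its images under the generators are linearly independent,
    so they span the module and detect the defect. *)
Let defect_nonnull X Y : formv X X != 0 -> defect X Y = 0.
Proof.
move=> XX; have dX : formv (defect X Y) X = 0.
  by rewrite /defect !(spE spv) act_isotropic (sp_sym spv Y X); ring.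
have dW W : formv (defect X Y) (W ** X) = 0.
  rewrite /defect !(spE spv) act_form bracketE (sp_sym spv Y) (sp_sym spv X (_ *m _)).
  by rewrite act_isotropic; ring.
pose T := row_mx (mx_of (fun Z => Z ** X)) X : 'M[R]_(dimv M, r + s + 1).
have TE (z : 'cV[R]_(r + s + 1)) : T *m z = usubmx z ** X + dsubmx z 0 0 *: X.
  rewrite -[z in LHS]vsubmxK mul_row_col mx_ofE => [|a x y]; last by rewrite !actE.
  by rewrite [dsubmx z in LHS]mx11_scalar mul_mx_scalar.
have Tfree : row_free T^T.
  rewrite -kermx_eq0; apply/eqP/row_matrixP => i; rewrite row0.
  apply: trmx_inj; rewrite trmx0; set z := (row _ _)^T.
  have : T *m z = 0.
    by rewrite -[T]trmxK -trmx_mul -row_mul mulmx_ker row0 trmx0.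
  rewrite TE => Tz; have := congr1 (fun v => formv v X) Tz.
  rewrite /= !(spE spv) act_isotropic add0r => /eqP.
  rewrite mulf_eq0 (negPf XX) orbF => /eqP z1.
  move: Tz; rewrite z1 scale0r addr0 => z2.
  rewrite -[z]vsubmxK [dsubmx z]mx11_scalar z1 raddf0.
  rewrite (_ : usubmx z = 0) ?col_mx0 //; apply: (sp_inj spz) => W.
  have := congr1 (fun v => formv v (W ** X)) z2; rewrite /= act_form !(spE spv) (spE spz) => /eqP.
  by rewrite mulf_eq0 (negPf XX) orbF => /eqP.
have /row_freeP[B TB] : row_free T.
  rewrite /row_free eqn_leq rank_leq_row -(mxrank_tr T) (eqP Tfree).
  by rewrite addn1.
apply: (sp_nondeg spv) => y; rewrite -[y]mul1mx -TB -mulmxA TE.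
by rewrite (spDr spv) (spZr spv) dX dW mulr0 addr0.
Qed.

(** The vanishing of the defect extends to null vectors by the parallelogram
    identity, the defect being quadratic in [X]. *)
Lemma bracket_act X Y : bracket_v X Y ** X = formv X X *: Y - formv X Y *: X.
Proof.
suff H : defect X Y = 0.
  move: H; rewrite /defect; move: (_ ** X) => V /colP H.
  by apply/colP => i; have := H i; rewrite !mxE; lra.
have [XX|/defect_nonnull->//] := eqVneq (formv X X) 0.
have [d0|d0] := posnP (dimv M).
  by apply/colP => i; have := ltn_ord i; rewrite {2}d0.
have [N NN] := sp_nonnull spv d0.
have par X' : defect (X + X') Y + defect (X + (-1) *: X') Y = 2 *: (defect X Y + defect X' Y).
  rewrite /defect !bracketDl !bracketZl !actE !(spE spv) (sp_sym spv X' X).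
  move: (bracket_v X Y ** X) (bracket_v X' Y ** X') => V1 V2.
  move: (bracket_v X Y ** X') (bracket_v X' Y ** X) => V3 V4.
  by apply/colP => i; rewrite !mxE; ring.
have good t : t != 0 -> t * formv N N + 2 * formv X N != 0 ->
    t * formv N N - 2 * formv X N != 0 -> defect X Y = 0.
  move=> t0 tp tm; have := par (t *: N).
  rewrite (defect_nonnull (X := t *: N)); last by rewrite !(spE spv) !mulf_neq0.
  rewrite (defect_nonnull (X := X + t *: N)).
    rewrite (defect_nonnull (X := X + _ *: (t *: N))).
      by rewrite !addr0 => /esym/eqP; rewrite scaler_eq0 pnatr_eq0 => /eqP.
    rewrite !(spE spv) XX (sp_sym spv N X).
    by rewrite (_ : _ + _ = t * (t * formv N N - 2 * formv X N)) ?mulf_neq0 //; ring.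
  rewrite !(spE spv) XX (sp_sym spv N X).
  by rewrite (_ : _ + _ = t * (t * formv N N + 2 * formv X N)) ?mulf_neq0 //; ring.
have [|m1] := eqVneq (1 * formv N N + 2 * formv X N) 0.
  move=> H; apply: (good 2); rewrite ?pnatr_eq0 //; apply/eqP; lra.
have [|p1] := eqVneq (1 * formv N N - 2 * formv X N) 0.
  by move=> H; apply: (good 2); rewrite ?pnatr_eq0 //; apply/eqP; lra.
exact: (good 1 (oner_neq0 _)).
Qed.

(** The annihilator of all pairs [(C Z, A X)], for [(C, A)] in the spin algebra,
    consists of the pairs [(W, Y)] for which the 2-form part of [X /\ Y] is a
    multiple of [Z /\ W]. Contracting with the 1-form part [P = [X, Y]] gives
    [<P, Z> W = <P, W> Z]. If [<P, Z> <> 0], the vectors [W] and [Z] are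
    proportional and the 2-form part vanishes, which leaves no room for [P]. *)
Lemma spin_annihilator Z W X Y : (2 <= r)%N ->
  (forall U V, sp_rs ((spin M U V).1 *m Z) W + formv ((spin M U V).2 *m X) Y = 0) ->
  formv (Z ** X) Y = 0.
Proof.
move=> r2 H; rewrite -bracketE; set P := bracket_v X Y.
have PE Q : formv (Q ** X) Y = sp_rs P Q by rewrite bracketE.
have {}H U V : 2 * (sp_rs U Z * sp_rs V W - sp_rs V Z * sp_rs U W)
    + formv (U ** V ** X) Y + sp_rs U V * formv X Y = 0.
  by have := H U V; rewrite spin1E spin2E !(spE spz) !(spE spv); lra.
apply/eqP/negP => /negP PZ.
have PY : P ** Y = formv X Y *: Y - formv Y Y *: X.
  rewrite /P bracketC actNl bracket_act (sp_sym spv Y X).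
  by rewrite opprB.
have WE : W = (sp_rs P W / sp_rs P Z) *: Z.
  apply: (sp_inj spz) => V; have := H P V.
  rewrite act_skew PY !(spE spv) act_isotropic PE => H1.
  apply: (mulfI PZ); rewrite (spE spz) [RHS]mulrA mulrCA divff // mulr1.
  rewrite (sp_sym spz W) (sp_sym spz Z); lra.
have HXY U V : formv (U ** V ** X) Y = - (sp_rs U V * formv X Y).
  have := H U V; rewrite WE !(spE spz); lra.
have UPX U : sp_rs P U *: (U ** X) = sp_rs U U *: (P ** X).
  have bUY : bracket_v X (U ** Y) = formv X Y *: U.
    apply: (sp_inj spz) => V; rewrite bracketE (spE spz).
    have := act_skew U (V ** X) Y; rewrite HXY; lra.
  have := bracket_act X (U ** Y); rewrite bUY => /(congr1 (mulmx (J M U))).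
  have -> : formv X (U ** Y) = - sp_rs P U.
    by rewrite -PE act_skew opprK.
  rewrite bracket_act !actE !act_sq; move: (U ** X) => V /colP H1.
  by apply/colP => i; have := H1 i; rewrite !mxE; lra.
have PX : P ** X = 0.
  (* Two positive directions contain a positive vector orthogonal to [P]. *)
  have [U PU UU] : exists2 U, sp_rs P U = 0 & sp_rs U U != 0.
    pose i0 : 'I_r := Ordinal (ltnW r2); pose i1 : 'I_r := Ordinal r2.
    pose e0 : 'cV[R]_(r + s) := delta_mx (lshift s i0) 0.
    pose e1 : 'cV[R]_(r + s) := delta_mx (lshift s i1) 0.
    have e00 : sp_rs e0 e0 = 1 by exact: sp_rs_lshift.
    have e11 : sp_rs e1 e1 = 1 by exact: sp_rs_lshift.
    have e01 : sp_rs e0 e1 = 0.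
      by apply: sp_rs_perp; rewrite (inj_eq (@lshift_inj _ _)).
    have [P0|P0] := eqVneq (sp_rs P e0) 0.
      by exists e0; rewrite ?e00 ?oner_neq0.
    exists (sp_rs P e1 *: e0 - sp_rs P e0 *: e1); rewrite !(spE spz); first by ring.
    rewrite e00 e11 e01 (sp_sym spz e1) e01.
    rewrite (_ : _ + _ = sp_rs P e1 ^+ 2 + sp_rs P e0 ^+ 2); last by ring.
    by rewrite paddr_eq0 ?sqr_ge0 // negb_and !sqrf_eq0 P0 orbT.
  have := UPX U; rewrite PU scale0r => /esym/eqP.
  by rewrite scaler_eq0 (negPf UU) => /eqP.
have := UPX Z; rewrite PX scaler0 => /eqP; rewrite scaler_eq0 (negPf PZ) => /eqP ZX.
by move: PZ; rewrite -PE ZX (sp0l spv) eqxx.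
Qed.

(** By duality it suffices that [(0, J_Z X)] is orthogonal to the annihilator. *)
Lemma spin_solvable Z X : (2 <= r)%N ->
  exists D, [/\ @in_lieH R r s M D, D.1 *m Z = 0 & D.2 *m X = Z ** X].
Proof.
move=> r2; pose T := ('I_(r + s) * 'I_(r + s))%type.
pose D (t : T) := spin M (delta_mx t.1 0) (delta_mx t.2 0).
pose g t := row_mx (((D t).1 *m Z)^T) (((D t).2 *m X)^T).
have [y Hy|c cE] := combination_of_annihilators (g := g) (v := row_mx 0 (Z ** X)^T).
  have [W WE] := sp_riesz spz (usubmx y); have [Y YE] := sp_riesz spv (dsubmx y).
  have gE (x : 'cV[R]_(r + s)) (x' : 'cV[R]_(dimv M)) :
      row_mx x^T x'^T *m y = (sp_rs x W + formv x' Y)%:M.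
    by rewrite -[y]vsubmxK mul_row_col WE YE [LHS]mx11_scalar mxE.
  have := gE 0 (Z ** X); rewrite trmx0 => ->; rewrite (sp0l spz) add0r.
  rewrite (spin_annihilator (W := W) r2) ?raddf0 //.
  pose f U V := 2 * (sp_rs U Z * sp_rs V W - sp_rs V Z * sp_rs U W)
    + formv (U ** V ** X) Y + sp_rs U V * formv X Y.
  have fE U V : sp_rs ((spin M U V).1 *m Z) W + formv ((spin M U V).2 *m X) Y = f U V.
    by rewrite spin1E spin2E !(spE spz) !(spE spv) /f; ring.
  move=> U V; rewrite fE; apply: (linear_basis0 (f := fun U => f U V)).
    by move=> a U1 U2; rewrite /f !(spE spz) !actE !(spE spv); ring.
  move=> i; apply: (linear_basis0 (f := f (delta_mx i 0))).
    by move=> a V1 V2; rewrite /f !(spE spz) !actE !(spE spv); ring.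
  move=> j; have := Hy (i, j); rewrite /g gE fE => /matrixP/(_ 0 0).
  by rewrite !mxE eqxx mulr1n.
exists (\sum_t c t *: D t); split.
- by apply: in_lieH_sum => t; exact: in_lieH_spin.
- have := congr1 (fun v => (lsubmx v)^T) cE; rewrite /= row_mxKl trmx0 => ->.
  rewrite raddf_sum mulmx_suml !raddf_sum; apply: eq_bigr => t _ /=.
  by rewrite -scalemxAl !linearZ /= row_mxKl trmxK.
- have := congr1 (fun v => (rsubmx v)^T) cE; rewrite /= row_mxKr trmxK => ->.
  rewrite raddf_sum mulmx_suml !raddf_sum; apply: eq_bigr => t _ /=.
  by rewrite -scalemxAl !linearZ /= row_mxKr trmxK.
Qed.

End SplitOctonions.

(** * Curves of matrices and the matrix exponential *)

Section MatrixCurves.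
Variable R : realType.

Definition vel_at m n (t : R) (f : R -> 'M[R]_(m, n)) (d : 'M[R]_(m, n)) :=
  forall i j, is_derive t (1 : R) (fun u => f u i j) (d i j).

Lemma is_derive_unique (f : R -> R) (t a b : R) :
  is_derive t (1 : R) f a -> is_derive t (1 : R) f b -> a = b.
Proof. by move=> [_ <-] [_ <-]. Qed.

Lemma is_derive_mul (f g : R -> R) (t a b : R) :
  is_derive t (1 : R) f a -> is_derive t (1 : R) g b ->
  is_derive t (1 : R) (fun u => f u * g u) (a * g t + f t * b).
Proof.
move=> fa gb; have := is_deriveM fa gb.
rewrite (_ : f t *: b + g t *: a = a * g t + f t * b) //.
by rewrite addrC [a * _]mulrC.
Qed.

Lemma is_derive_bigsum n (h : 'I_n -> R -> R) (dh : 'I_n -> R) (t : R) :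
  (forall i, is_derive t (1 : R) (h i) (dh i)) ->
  is_derive t (1 : R) (fun u => \sum_i h i u) (\sum_i dh i).
Proof.
move=> H; have := is_derive_sum H.
rewrite (_ : \sum_(i < n) h i = fun u => \sum_i h i u) //.
by apply/funext => u; rewrite fct_sumE.
Qed.

Lemma vel_at_unique m n t (f : R -> 'M[R]_(m, n)) d d' :
  vel_at t f d -> vel_at t f d' -> d = d'.
Proof. by move=> H H'; apply/matrixP => i j; apply: is_derive_unique (H i j) (H' i j). Qed.

Lemma velocityE m n t (f : R -> 'M[R]_(m, n)) d : vel_at t f d -> velocity f t = d.
Proof.
by move=> H; apply/matrixP => i j; rewrite mxE derive1E; apply: derive_val.
Qed.

Lemma smooth_vel_at m n t (f : R -> 'M[R]_(m, n)) (D : set R) :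
  smooth_on D f -> D t -> vel_at t f (velocity f t).
Proof.
move=> H Dt i j; rewrite mxE derive1E; apply: derivableP.
exact: (H i j 0%N).
Qed.

Lemma vel_at_ext m n t (f g : R -> 'M[R]_(m, n)) d :
  (forall u, f u = g u) -> vel_at t f d -> vel_at t g d.
Proof. by move=> fg; rewrite (_ : f = g) //; apply/funext. Qed.

Lemma vel_at_cst m n t (A : 'M[R]_(m, n)) : vel_at t (fun=> A) 0.
Proof. by move=> i j; rewrite mxE; apply: is_derive_cst. Qed.

Lemma vel_atD m n t (f g : R -> 'M[R]_(m, n)) d d' :
  vel_at t f d -> vel_at t g d' -> vel_at t (fun u => f u + g u) (d + d').
Proof.
move=> H H' i j; rewrite mxE; have := is_deriveD (H i j) (H' i j).
by congr is_derive; apply/funext => u; rewrite mxE.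
Qed.

Lemma vel_atN m n t (f : R -> 'M[R]_(m, n)) d :
  vel_at t f d -> vel_at t (fun u => - f u) (- d).
Proof.
move=> H i j; rewrite mxE; have := is_deriveN (H i j).
by congr is_derive; apply/funext => u; rewrite mxE.
Qed.

Lemma vel_atZ m n t (k : R -> R) (f : R -> 'M[R]_(m, n)) a d :
  is_derive t (1 : R) k a -> vel_at t f d ->
  vel_at t (fun u => k u *: f u) (a *: f t + k t *: d).
Proof.
move=> ka H i j; rewrite !mxE; have := is_derive_mul ka (H i j).
by congr is_derive; apply: funext => u; rewrite mxE.
Qed.

Lemma vel_at_reparam m n t (f : R -> 'M[R]_(m, n)) d (phi : R -> R) k :
  vel_at (phi t) f d -> is_derive t (1 : R) phi k ->
  vel_at t (fun u => f (phi u)) (k *: d).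
Proof.
by move=> H phik i j; rewrite mxE mulrC; apply: is_derive1_comp (H i j) phik.
Qed.

Lemma vel_at_shift m n t u (f : R -> 'M[R]_(m, n)) d :
  vel_at (t + u) f d -> vel_at t (fun x => f (x + u)) d.
Proof.
move=> H; rewrite -[d]scale1r; apply: (vel_at_reparam (phi := fun x => x + u)) H _.
exact: is_derive_shift.
Qed.

Lemma vel_at_opp m n t (f : R -> 'M[R]_(m, n)) d :
  vel_at (- t) f d -> vel_at t (fun x => f (- x)) (- d).
Proof.
move=> H; rewrite -scaleN1r; exact: (vel_at_reparam (phi := -%R)) H _.
Qed.

Lemma vel_at_linear m n k l (L : 'M[R]_(m, n) -> 'M[R]_(k, l)) t (f : R -> 'M[R]_(m, n)) d :
  linear L -> vel_at t f d -> vel_at t (fun u => L (f u)) (L d).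
Proof.
move=> Llin H i j.
have LE A : L A i j = \sum_a \sum_b A a b * L (delta_mx a b) i j.
  pose L' : {linear 'M[R]_(m, n) -> 'M[R]_(k, l)} :=
    HB.pack L (GRing.isLinear.Build _ _ _ _ L Llin).
  rewrite -[L]/(L' : _ -> _) {1}[A]matrix_sum_delta linear_sum summxE.
  apply: eq_bigr => a _; rewrite linear_sum summxE; apply: eq_bigr => b _.
  by rewrite linearZ mxE.
rewrite LE (_ : (fun u => _) = (fun u => \sum_a \sum_b f u a b * L (delta_mx a b) i j)).
  apply: is_derive_bigsum => a; apply: is_derive_bigsum => b.
  have := is_derive_mul (H a b) (is_derive_cst (L (delta_mx a b) i j) t (1 : R)).
  by rewrite mulr0 addr0.
by apply/funext => u; exact: LE.
Qed.

Lemma vel_at_bilinear m n p q k l (B : 'M[R]_(m, n) -> 'M[R]_(p, q) -> 'M[R]_(k, l)) t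
    (f : R -> 'M[R]_(m, n)) (g : R -> 'M[R]_(p, q)) d d' :
  (forall C, linear (B^~ C)) -> (forall A, linear (B A)) ->
  vel_at t f d -> vel_at t g d' ->
  vel_at t (fun u => B (f u) (g u)) (B d (g t) + B (f t) d').
Proof.
move=> Bl Br Hf Hg i j; rewrite mxE.
have BE A C : B A C i j = \sum_a \sum_b A a b * B (delta_mx a b) C i j.
  pose L' : {linear 'M[R]_(m, n) -> 'M[R]_(k, l)} :=
    HB.pack (B^~ C) (GRing.isLinear.Build _ _ _ _ (B^~ C) (Bl C)).
  rewrite -[B A C]/(L' A) {1}[A]matrix_sum_delta linear_sum summxE.
  apply: eq_bigr => a _; rewrite linear_sum summxE; apply: eq_bigr => b _.
  by rewrite linearZ mxE.
rewrite !BE -big_split (_ : (fun u => _) =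
    (fun u => \sum_a \sum_b f u a b * B (delta_mx a b) (g u) i j)).
  apply: is_derive_bigsum => a; rewrite -big_split; apply: is_derive_bigsum => b.
  apply: is_derive_mul (Hf a b) _.
  exact: (vel_at_linear (Br (delta_mx a b)) Hg).
by apply/funext => u; exact: BE.
Qed.

Lemma vel_at_mul m n p t (f : R -> 'M[R]_(m, n)) (g : R -> 'M[R]_(n, p)) d d' :
  vel_at t f d -> vel_at t g d' ->
  vel_at t (fun u => f u *m g u) (d *m g t + f t *m d').
Proof.
apply: (vel_at_bilinear (B := mulmx)) => [C a A B|A a C B].
  by rewrite mulmxDl -scalemxAl.
by rewrite mulmxDr -scalemxAr.
Qed.

Lemma vel_at_mull m n p t (A : 'M[R]_(m, n)) (g : R -> 'M[R]_(n, p)) d :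
  vel_at t g d -> vel_at t (fun u => A *m g u) (A *m d).
Proof.
by move=> H; have := vel_at_mul (vel_at_cst t A) H; rewrite mul0mx add0r.
Qed.

Lemma vel_at_mulr m n p t (f : R -> 'M[R]_(m, n)) (A : 'M[R]_(n, p)) d :
  vel_at t f d -> vel_at t (fun u => f u *m A) (d *m A).
Proof.
by move=> H; have := vel_at_mul H (vel_at_cst t A); rewrite mulmx0 addr0.
Qed.

Lemma vel_at0_const m n (f : R -> 'M[R]_(m, n)) :
  (forall t, vel_at t f 0) -> forall t u, f t = f u.
Proof.
move=> H t u; apply/matrixP => i j.
apply: (@is_derive_0_is_cst _ (fun x => f x i j)) => x.
by have := H x i j; rewrite mxE.
Qed.

(** Solutions of a linear equation with constant coefficients are smooth, the
    iterated derivatives being again linear in the solution. *)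
Lemma linear_ode_smooth m n (A : 'M[R]_m) (f : R -> 'M[R]_(m, n)) :
  (forall t, vel_at t f (A *m f t)) -> smooth_on setT f.
Proof.
move=> H i j.
have E k : derive1n k (fun u => f u i j) = fun u => (A ^+ k *m f u) i j.
  elim: k => [|k IH]; first by apply/funext => u; rewrite mul1mx.
  apply/funext => u; rewrite derive1nS IH derive1E.
  have [_ ->] := vel_at_mull (A ^+ k) (H u) i j.
  by rewrite mulmxA exprSr.
move=> k t _; rewrite E.
by case: (vel_at_mull (A ^+ k) (H t) i j).
Qed.

Section Exponential.
Variables (d : nat) (A : 'M[R]_d).

(** Coefficients of the [k]-th derivative of an entry of the exponential: the
    shift makes differentiation of power series act by increasing [k]. *)
Definition mexp_coef k i j n : R := (A ^+ (n + k)) i j / n`!%:R.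

Definition mexp t : 'M[R]_d := \matrix_(i, j) limn (pseries (mexp_coef 0 i j) t).

Let K : R := 1 + \sum_i \sum_j `|A i j|.

Let pow_le n i j : `|(A ^+ n) i j| <= K ^+ n.
Proof.
have K1 : 1 <= K by rewrite lerDl; apply: sumr_ge0 => a _; apply: sumr_ge0.
elim: n i j => [|n IH] i j.
  by rewrite expr0 mxE; case: (i == j); rewrite ?normr1 ?normr0 ?ler01.
rewrite exprS mxE exprS; apply: le_trans (ler_norm_sum _ _ _) _.
apply: le_trans (_ : \sum_a `|A i a| * K ^+ n <= _).
  by apply: ler_sum => a _; rewrite normrM ler_wpM2l.
rewrite -mulr_suml ler_wpM2r ?exprn_ge0 //; first exact: le_trans ler01 K1.
rewrite /K [X in _ <= _ + X](bigD1 i) //= addrCA lerDl addr_ge0 //.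
by apply: sumr_ge0 => a _; apply: sumr_ge0.
Qed.

Let cvg_coef k i j t : cvgn (pseries (mexp_coef k i j) t).
Proof.
have K0 : 0 <= K by rewrite addr_ge0 //; apply: sumr_ge0 => a _; apply: sumr_ge0.
apply: normed_cvg; apply: (series_le_cvg _ _ _
    (is_cvg_seriesZ (k := K ^+ k) (is_cvg_series_exp_coeff (K * `|t|)))) => n.
- exact: normr_ge0.
- by rewrite mulr_ge0 ?exprn_ge0 // exp_coeff_ge0 // mulr_ge0.
rewrite [leRHS](_ : _ = K ^+ (n + k) / n`!%:R * `|t| ^+ n).
  rewrite /= /mexp_coef !normrM normfV normr_nat normrX.
  by rewrite ler_wpM2r ?exprn_ge0 // ler_wpM2r ?invr_ge0.
transitivity (K ^+ k * ((K * `|t|) ^+ n / n`!%:R)) => //.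
by rewrite exprMn exprD; ring.
Qed.

Let diffs k i j : pseries_diffs (mexp_coef k i j) = mexp_coef k.+1 i j.
Proof.
apply/funext => n; rewrite /pseries_diffs /mexp_coef factS natrM addnS addSn.
by rewrite mulrCA invfM; congr (_ * _); rewrite mulrA divff ?mul1r // pnatr_eq0.
Qed.

Let vel_mexp t :
  vel_at t mexp (\matrix_(i, j) limn (pseries (mexp_coef 1 i j) t)).
Proof.
move=> i j; rewrite (_ : (fun u => _) = fun u => limn (pseries (mexp_coef 0 i j) u)).
  rewrite mxE -diffs; apply: (@pseries_snd_diffs _ _ (`|t| + 1)); rewrite ?diffs //.
  by rewrite [ltRHS]ger0_norm ?ltrDl // addr_ge0.
by apply/funext => u; rewrite mxE.
Qed.

Let lim_comb (c : 'I_d -> R) (u : 'I_d -> R ^nat) (v : R ^nat) :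
  (forall a, cvgn (u a)) -> (forall n, v n = \sum_a c a * u a n) ->
  limn v = \sum_a c a * limn (u a).
Proof.
move=> cu vE; rewrite (_ : v = fun n => \sum_a c a * u a n); last exact/funext.
apply/cvg_lim => //; apply: cvg_big => [|a _]; first exact: add_continuous.
by apply: cvgMr; exact: cu.
Qed.

Lemma vel_at_mexp t : vel_at t mexp (A *m mexp t).
Proof.
have := vel_mexp t; congr vel_at; apply/matrixP => i j; rewrite !mxE.
rewrite (lim_comb (c := A i) (u := fun a => pseries (mexp_coef 0 a j) t)) //.
  by apply: eq_bigr => a _; rewrite mxE.
move=> n; under [RHS]eq_bigr => a _ do rewrite /pseries /series /= mulr_sumr.
rewrite /pseries /series /= exchange_big /=; apply: eq_bigr => b _.
rewrite /mexp_coef addn1 addn0 exprS mxE !mulr_suml; apply: eq_bigr => a _.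
by rewrite !mulrA.
Qed.

Lemma vel_at_mexp_r t : vel_at t mexp (mexp t *m A).
Proof.
have := vel_mexp t; congr vel_at; apply/matrixP => i j; rewrite !mxE.
rewrite (lim_comb (c := A^~ j) (u := fun a => pseries (mexp_coef 0 i a) t)) //.
  by apply: eq_bigr => a _; rewrite mxE mulrC.
move=> n; under [RHS]eq_bigr => a _ do rewrite /pseries /series /= mulr_sumr.
rewrite /pseries /series /= exchange_big /=; apply: eq_bigr => b _.
rewrite /mexp_coef addn1 addn0 exprSr mxE !mulr_suml; apply: eq_bigr => a _.
by rewrite [A a j * _]mulrC; ring.
Qed.

Lemma mexp0 : mexp 0 = 1%:M.
Proof.
apply/matrixP => i j; rewrite [LHS]mxE; apply: lim_near_cst => //.
near=> n; rewrite -[n]prednK; last by near: n.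
rewrite /pseries /series /= big_nat_recl // big1 ?addr0.
  by rewrite /mexp_coef expr0 mulr1 fact0 divr1.
by move=> b _; rewrite expr0n mulr0.
Unshelve. all: by end_near. Qed.

Lemma mexpNK t : mexp (- t) *m mexp t = 1%:M.
Proof.
transitivity (mexp (- 0) *m mexp 0); last by rewrite oppr0 mexp0 mulmx1.
apply: (vel_at0_const (f := fun t => mexp (- t) *m mexp t)) => u.
have := vel_at_mul (vel_at_opp (vel_at_mexp_r (- u))) (vel_at_mexp u).
by rewrite mulNmx -mulmxA addNr.
Qed.

(** [mexp (- t) *m f t] is constant along solutions. *)
Lemma linear_ode_unique n (f g : R -> 'M[R]_(d, n)) :
  (forall t, vel_at t f (A *m f t)) -> (forall t, vel_at t g (A *m g t)) ->
  f 0 = g 0 -> forall t, f t = g t.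
Proof.
have sol h : (forall t, vel_at t h (A *m h t)) -> forall t, h t = mexp t *m h 0.
  move=> H t; have : mexp (- t) *m h t = h 0.
    transitivity (mexp (- 0) *m h 0); last by rewrite oppr0 mexp0 mul1mx.
    apply: (vel_at0_const (f := fun t => mexp (- t) *m h t)) => u.
    have := vel_at_mul (vel_at_opp (vel_at_mexp_r (- u))) (H u).
    by rewrite mulNmx -mulmxA addNr.
  by move=> <-; have := mexpNK (- t); rewrite opprK mulmxA => ->; rewrite mul1mx.
by move=> Hf Hg fg t; rewrite sol // fg -sol.
Qed.

End Exponential.

Lemma mexpD d (A : 'M[R]_d) t u : mexp A (t + u) = mexp A t *m mexp A u.
Proof.
apply: (linear_ode_unique (f := fun t => mexp A (t + u))
    (g := fun t => mexp A t *m mexp A u)) => [{}t|{}t|].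
- exact/vel_at_shift/vel_at_mexp.
- by rewrite mulmxA; exact/vel_at_mulr/vel_at_mexp.
by rewrite add0r mexp0 mul1mx.
Qed.

End MatrixCurves.

(** * Geodesics of the left-invariant metric *)

Section NilpotentGroup.
Variables (R : realType) (r s : nat) (M : admissible_module R r s).
Local Notation n := 'cV[R]_(r + s + dimv M).
Implicit Types (p q u w x y : n).

Local Notation spv := (formv_sp M).
Local Notation spz := (@sp_rsP R r s).
Local Notation br := (@bracket_n R r s M).

Lemma sp_nP : scalar_product (@sp_n R r s M).
Proof.
split=> [x y|a x y z|x H].
- by rewrite /sp_n (sp_sym spz) (sp_sym spv).
- by rewrite /sp_n !linearP /= !(spE spz) !(spE spv); ring.
rewrite -[x]vsubmxK (_ : usubmx x = 0) 1?(_ : dsubmx x = 0) ?col_mx0 //.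
  apply: (sp_nondeg spv) => Y; have := H (col_mx 0 Y).
  by rewrite /sp_n col_mxKu col_mxKd (sp0r spz) add0r.
apply: (sp_nondeg spz) => Z; have := H (col_mx Z 0).
by rewrite /sp_n col_mxKu col_mxKd (sp0r spv) addr0.
Qed.

Local Notation spn := sp_nP.

Lemma bracket_nPl y : linear (br^~ y).
Proof.
move=> a x x'; rewrite /bracket_n !linearP /= bracketDl bracketZl.
by rewrite scale_col_mx add_col_mx scaler0 addr0.
Qed.

Lemma bracket_nPr x : linear (br x).
Proof.
move=> a y y'; rewrite /bracket_n !linearP /= bracketDr bracketZr.
by rewrite scale_col_mx add_col_mx scaler0 addr0.
Qed.

Lemma bracket_nDl x x' y : br (x + x') y = br x y + br x' y.
Proof. by have := bracket_nPl y 1 x x'; rewrite !scale1r. Qed.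

Lemma bracket_n0l y : br 0 y = 0.
Proof. by have := bracket_nPl y (-1) 0 0; rewrite scaler0 addr0 scaleN1r addNr. Qed.

Lemma bracket_nZl a x y : br (a *: x) y = a *: br x y.
Proof. by have := bracket_nPl y a x 0; rewrite bracket_n0l !addr0. Qed.

Lemma bracket_nDr x x' y : br y (x + x') = br y x + br y x'.
Proof. by have := bracket_nPr y 1 x x'; rewrite !scale1r. Qed.

Lemma bracket_n0r y : br y 0 = 0.
Proof. by have := bracket_nPr y (-1) 0 0; rewrite scaler0 addr0 scaleN1r addNr. Qed.

Lemma bracket_nZr a x y : br y (a *: x) = a *: br y x.
Proof. by have := bracket_nPr y a x 0; rewrite bracket_n0r !addr0. Qed.

Lemma bracket_nC x y : br y x = - br x y.
Proof. by rewrite /bracket_n bracketC opp_col_mx oppr0. Qed.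

Lemma bracket_nxx x : br x x = 0.
Proof.
have /eqP := bracket_nC x x; rewrite -subr_eq0 opprK -mulr2n -scaler_nat.
by rewrite scaler_eq0 pnatr_eq0 => /eqP.
Qed.

Lemma bracket_n_nil x y z : br x (br y z) = 0.
Proof.
by rewrite /bracket_n col_mxKd bracket0r col_mx0.
Qed.

Lemma bracket_n_nill x y z : br (br y z) x = 0.
Proof. by rewrite bracket_nC bracket_n_nil oppr0. Qed.

Definition brE := (bracket_nDl, bracket_nDr, bracket_nZl, bracket_nZr, bracket_n0l,
  bracket_n0r, bracket_nxx, bracket_n_nil, bracket_n_nill).

Lemma vel_at_line t x y : vel_at t (fun u : R => x + u *: y) y.
Proof.
rewrite -[X in vel_at _ _ X]add0r; apply: vel_atD; first exact: vel_at_cst.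
move=> i j; rewrite -[X in is_derive _ _ _ X]mul1r.
have := is_derive_mul (is_derive_id t (1 : R)) (is_derive_cst (y i j) t (1 : R)).
rewrite mulr0 addr0; congr is_derive.
by apply/funext => u; rewrite mxE.
Qed.

Lemma to_identityE p u : to_identity p u = u - 2^-1 *: br p u.
Proof.
apply: velocityE.
apply: (vel_at_ext (f := fun t : R => 0 + t *: (u - 2^-1 *: br p u))).
  move=> t; rewrite /mul_N -[- p]scaleN1r !brE scalerA.
  by apply/colP => i; rewrite !mxE; ring.
exact: vel_at_line.
Qed.

Lemma is_derive_sp_line (a b a' b' : n) :
  is_derive (0 : R) (1 : R) (fun t => sp_n (a + t *: b) (a' + t *: b'))
    (sp_n b a' + sp_n a b').
Proof.
pose B x y : 'M[R]_1 := (sp_n x y)%:M.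
have Bl C : linear (B^~ C).
  by move=> c x x'; rewrite /B !(spE spn) raddfD /= scale_scalar_mx.
have Br A : linear (B A).
  by move=> c x x'; rewrite /B !(spE spn) raddfD /= scale_scalar_mx.
have := vel_at_bilinear Bl Br (vel_at_line 0 a b) (vel_at_line 0 a' b').
rewrite !scale0r !addr0 => /(_ 0 0); rewrite /B 3!mxE eqxx !mulr1n.
by congr is_derive; apply: funext => t; rewrite mxE eqxx mulr1n.
Qed.

Lemma directional_metric p u v w :
  directional (fun q => @metric_N R r s M q v w) p u
  = - 2^-1 * (sp_n (br u v) (to_identity p w) + sp_n (to_identity p v) (br u w)).
Proof.
have line v' t : to_identity (p + t *: u) v' = to_identity p v' + t *: (- 2^-1 *: br u v').
  by rewrite !to_identityE !brE; apply/colP => i; rewrite !mxE; ring.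
rewrite /directional derive1E.
rewrite (_ : (fun t => _) = fun t => sp_n (to_identity p v + t *: (- 2^-1 *: br u v))
    (to_identity p w + t *: (- 2^-1 *: br u w))); last first.
  by apply: funext => t; rewrite /metric_N !line.
move: (to_identity p w) (to_identity p v) (br u v) (br u w) => a b c d.
by case: (is_derive_sp_line b (- 2^-1 *: c) a (- 2^-1 *: d)) => _ ->; rewrite !(spE spn); ring.
Qed.

(** The metric is quadratic in the base point, with linear part the bracket; the
    terms containing [[u, u]] vanish. *)
Lemma christoffel_metric p u w :
  christoffel (@metric_N R r s M) p u u w = - sp_n (to_identity p u) (br u w).
Proof.
have E (x y : R) : directional (fun q => @metric_N R r s M q u w) p u = x ->
    directional (fun q => @metric_N R r s M q u u) p w = y ->
    christoffel (@metric_N R r s M) p u u w = 2^-1 * (x + x - y).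
  by move=> <- <-.
rewrite (E _ _ (directional_metric p u u w) (directional_metric p w u u)) {E}.
have -> : br u u = 0 by exact: bracket_nxx.
have -> : br w u = - br u w by exact: bracket_nC.
move: (to_identity p u) (to_identity p w) (br u w) => a b c.
by rewrite !(spE spn) (sp_sym spn c); field.
Qed.

End NilpotentGroup.

Section GeodesicLemma.
Variables (R : realType) (r s : nat) (M : admissible_module R r s).
Local Notation n := 'cV[R]_(r + s + dimv M).
Local Notation blocks := ('M[R]_(r + s) * 'M[R]_(dimv M))%type.
Local Notation pairs := (n * blocks)%type.
Implicit Types (p q w x y : n).

Local Notation "Z ** X" := (J M Z *m X) (at level 41, right associativity).
Local Notation spv := (formv_sp M).
Local Notation spz := (@sp_rsP R r s).
Local Notation br := (@bracket_n R r s M).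

Lemma vel_at_block m k t (f : R -> 'M[R]_m) (g : R -> 'M[R]_k) d d' :
  vel_at t f d -> vel_at t g d' ->
  vel_at t (fun u => block_mx (f u) 0 0 (g u)) (block_mx d 0 0 d').
Proof.
move=> H H' i j; case: (split_ordP i) => a ->; case: (split_ordP j) => b ->.
- rewrite block_mxEul; have := H a b; congr is_derive.
  by apply: funext => u; rewrite block_mxEul.
- rewrite block_mxEur mxE; have := is_derive_cst (0 : R) t (1 : R); congr is_derive.
  by apply: funext => u; rewrite block_mxEur mxE.
- rewrite block_mxEdl mxE; have := is_derive_cst (0 : R) t (1 : R); congr is_derive.
  by apply: funext => u; rewrite block_mxEdl mxE.
- rewrite block_mxEdr; have := H' a b; congr is_derive.
  by apply: funext => u; rewrite block_mxEdr.
Qed.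

Lemma derive1_id (t : R) : derive1 (id : R -> R) t = 1.
Proof. by rewrite derive1E derive_id. Qed.

Lemma derivable_derive1n_id k (t : R) : derivable (derive1n k (id : R -> R)) t 1.
Proof.
case: k => [|k]; first exact: derivable_id.
have [a ->] : exists a : R, derive1n k.+1 (id : R -> R) = cst a.
  elim: k => [|k [a IH]]; first by exists 1; apply: funext => u; rewrite derive1n1 derive1_id.
  by exists 0; apply: funext => u; rewrite derive1nS IH derive1_cst.
exact: derivable_cst.
Qed.

Lemma vel_at_bracket t (f g : R -> n) d d' : vel_at t f d -> vel_at t g d' ->
  vel_at t (fun u => br (f u) (g u)) (br d (g t) + br (f t) d').
Proof. by apply: vel_at_bilinear => [C|A]; [exact: bracket_nPl|exact: bracket_nPr]. Qed.

Lemma vel_at_mulN t (f g : R -> n) d d' : vel_at t f d -> vel_at t g d' ->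
  vel_at t (fun u => mul_N (f u) (g u)) (d + d' + 2^-1 *: (br d (g t) + br (f t) d')).
Proof.
move=> H H'; apply: vel_atD; first exact: vel_atD.
have := vel_at_mull (2^-1)%:M (vel_at_bracket H H').
by rewrite mul_scalar_mx; apply: vel_at_ext => u; rewrite mul_scalar_mx.
Qed.

Lemma act_G0 (a : pairs) : act_G a 0 = a.1.
Proof. by rewrite /act_G /mul_N mulmx0 bracket_n0r scaler0 !addr0. Qed.

Lemma skew_of_orthogonal m (b : 'cV[R]_m -> 'cV[R]_m -> R) (bP : scalar_product b)
    (h : R -> 'M[R]_m) d :
  (forall t, orthogonal_mx b (h t)) -> h 0 = 1%:M -> vel_at 0 h d -> skew_mx b d.
Proof.
move=> ho h0 hd x y; pose B (x y : 'cV[R]_m) : 'M[R]_1 := (b x y)%:M.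
have Bl C : linear (B^~ C).
  by move=> a u v; rewrite /B !(spE bP) raddfD /= scale_scalar_mx.
have Br A : linear (B A).
  by move=> a u v; rewrite /B !(spE bP) raddfD /= scale_scalar_mx.
have H := vel_at_bilinear Bl Br (vel_at_mulr x hd) (vel_at_mulr y hd).
have H' : vel_at 0 (fun u : R => B (h u *m x) (h u *m y)) 0.
  by apply: (vel_at_ext _ (vel_at_cst 0 (B x y))) => u; rewrite /B ho.
have /matrixP/(_ 0 0) := vel_at_unique H H'.
by rewrite h0 !mul1mx !mxE eqxx !mulr1n; lra.
Qed.

Lemma orthogonal_flow m (b : 'cV[R]_m -> 'cV[R]_m -> R) (bP : scalar_product b)
    (A : 'M[R]_m) t : skew_mx b A -> orthogonal_mx b (mexp A t).
Proof.
move=> Ask x y; pose B (x y : 'cV[R]_m) : 'M[R]_1 := (b x y)%:M.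
have Bl C : linear (B^~ C).
  by move=> a u v; rewrite /B !(spE bP) raddfD /= scale_scalar_mx.
have Br C : linear (B C).
  by move=> a u v; rewrite /B !(spE bP) raddfD /= scale_scalar_mx.
have /matrixP/(_ 0 0) : B (mexp A t *m x) (mexp A t *m y) = B (mexp A 0 *m x) (mexp A 0 *m y).
  apply: (vel_at0_const (f := fun t => B (mexp A t *m x) (mexp A t *m y))) => u.
  have := vel_at_bilinear Bl Br (vel_at_mulr x (vel_at_mexp A u)) (vel_at_mulr y (vel_at_mexp A u)).
  by rewrite -!mulmxA /B Ask -raddfD /= addNr raddf0.
by rewrite /B mexp0 !mul1mx !mxE eqxx !mulr1n.
Qed.

Lemma orthogonal_idempotent m (b : 'cV[R]_m -> 'cV[R]_m -> R) (bP : scalar_product b)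
  (A : 'M[R]_m) : orthogonal_mx b A -> A = A *m A -> A = 1%:M.
Proof.
move=> /(orthogonal_unit bP) Au AA.
by rewrite -[LHS](mulKmx Au) -AA mulVmx.
Qed.

Lemma velocity_translate (p p' : R -> n) (h : R -> blocks) :
  (forall t u, p (t + u) = mul_N (p t) (mx_n (h t) *m p u)) ->
  (forall t, vel_at t p (p' t)) ->
  forall t, p' t = mx_n (h t) *m p' 0 + 2^-1 *: br (p t) (mx_n (h t) *m p' 0).
Proof.
move=> law vp t; have := vel_at_mulN (vel_at_cst 0 (p t)) (vel_at_mull (mx_n (h t)) (vp 0)).
rewrite bracket_n0l !add0r => H.
have H' : vel_at 0 (fun u => p (u + t)) (p' t) by apply: vel_at_shift; rewrite add0r.
by apply: vel_at_unique H' (vel_at_ext _ H) => u; rewrite addrC law.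
Qed.

(** Differentiating the group law once gives [p' t = d L_(p t) (h t p' 0)], and
    once more at [t = 0], where [h] has velocity [D], gives [p'' 0 = D (p' 0)]: the
    bracket contributes [[p' 0, p' 0] = 0]. *)
Lemma one_parameter_derivation (a : R -> pairs) : one_parameter_subgroup a ->
  exists2 D : blocks, in_lieH D &
    (a 0).1 = 0 -> vel_at 0 (velocity (fun t => (a t).1))
      (mx_n D *m velocity (fun t => (a t).1) 0).
Proof.
case=> sp s1 s2 aG law; pose p t := (a t).1; pose h1 t := (a t).2.1; pose h2 t := (a t).2.2.
have vp t : vel_at t p (velocity p t) by exact: smooth_vel_at sp I.
have v1 : vel_at 0 h1 (velocity h1 0) by exact: smooth_vel_at s1 I.
have v2 : vel_at 0 h2 (velocity h2 0) by exact: smooth_vel_at s2 I.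
have o1 t : orthogonal_mx (@sp_rs R r s) (h1 t) by case: (aG t).
have o2 t : orthogonal_mx (@formv R r s M) (h2 t) by case: (aG t).
have eq t Z : h2 t *m J M Z = J M (h1 t *m Z) *m h2 t.
  by case: (aG t) => _ _ <-; rewrite mulmxKV // (orthogonal_unit spv (o2 t)).
have law0 := law 0 0; rewrite addr0 in law0.
have h10 : h1 0 = 1%:M.
  by apply: (orthogonal_idempotent spz (o1 0)); exact: (congr1 (fun x : pairs => x.2.1) law0).
have h20 : h2 0 = 1%:M.
  by apply: (orthogonal_idempotent spv (o2 0)); exact: (congr1 (fun x : pairs => x.2.2) law0).
pose D : blocks := (velocity h1 0, velocity h2 0); exists D.
  split=> [||Z]; first exact: (skew_of_orthogonal spz o1 h10 v1).
    exact: (skew_of_orthogonal spv o2 h20 v2).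
  have H := vel_at_mulr (J M Z) v2.
  have HJ : vel_at 0 (fun t => J M (h1 t *m Z)) (J M (velocity h1 0 *m Z)).
    by apply: vel_at_linear (vel_at_mulr Z v1); exact: linearP.
  have {H}H := vel_at_unique (vel_at_ext (fun t => eq t Z) H) (vel_at_mul HJ v2).
  by rewrite /= H h10 h20 mul1mx mulmx1 addrK.
move=> p0'; have p0 : p 0 = 0 by []; rewrite -/p.
have p'E := velocity_translate (h := fun t => (a t).2) (fun t u => congr1 fst (law t u)) vp.
have vh : vel_at 0 (fun t => mx_n (a t).2) (mx_n D) by exact: vel_at_block v1 v2.
have v' := vel_at_mulr (velocity p 0) vh.
have {}v' := vel_atD v' (vel_at_mull (2^-1)%:M (vel_at_bracket (vp 0) v')).
have h0 : mx_n (a 0).2 = 1%:M by rewrite /mx_n -/(h1 0) -/(h2 0) h10 h20 -scalar_mx_block.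
rewrite h0 mul1mx bracket_nxx p0 bracket_n0l addr0 mulmx0 addr0 in v'.
by apply: (vel_at_ext _ v') => t; rewrite mul_scalar_mx -p'E.
Qed.

(** At the base point the geodesic equation reads [<c'', u> = <J_Z X, u>], while
    an orbit [c o phi] has [c'' = D' w - k w] with [D'] in the isotropy algebra; the
    equation at this single point already gives the condition. *)
Lemma geodesic_orbit_condition : geodesic_orbit M -> go_condition M.
Proof.
move=> go Z X; have [c [phi [a [[[phis phi1] phi0] [cs geo] [c0 c1] sub orb]]]] := go (col_mx Z X).
have [D Dh vD] := one_parameter_derivation sub.
have pE t : (a t).1 = c (phi t) by rewrite orb act_G0.
have p0 : (a 0).1 = 0 by rewrite pE phi0.
have {}vD := vD p0.
have rng t : range phi (phi t) by exists t.
have vphi t : is_derive t (1 : R) phi (derive1 phi t).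
  by rewrite derive1E; apply: derivableP; exact: (phis 0%N t).
have vphi' : is_derive (0 : R) (1 : R) (derive1 phi) (derive1 (derive1 phi) 0).
  by rewrite [X in is_derive _ _ _ X]derive1E; apply: derivableP; exact: (phis 1%N 0).
have vc t : vel_at (phi t) c (velocity c (phi t)) by exact: smooth_vel_at cs (rng t).
have vc' : vel_at (phi 0) (velocity c) (velocity (velocity c) (phi 0)).
  move=> i j; rewrite mxE [X in is_derive _ _ _ X]derive1E; apply: derivableP.
  rewrite (_ : (fun u => _) = derive1 (fun u => c u i j)); last first.
    by apply: funext => u; rewrite mxE.
  exact: (cs i j 1%N (phi 0) (rng 0)).
have p'E t : velocity (fun t => (a t).1) t = derive1 phi t *: velocity c (phi t).
  apply: velocityE; apply: (vel_at_ext _ (vel_at_reparam (vc t) (vphi t))) => u.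
  by rewrite pE.
set k := derive1 phi 0; set k' := derive1 (derive1 phi) 0; set c2 := velocity (velocity c) 0.
have acc : mx_n D *m (k *: col_mx Z X) = k' *: col_mx Z X + k *: (k *: c2).
  apply: vel_at_unique (_ : vel_at 0 (velocity (fun t => (a t).1)) _) _.
    by move: vD; rewrite p'E phi0 c1.
  have := vel_atZ vphi' (vel_at_reparam vc' (vphi 0)).
  by rewrite phi0 c1; apply: vel_at_ext => t; rewrite p'E.
have k0 : k != 0 by exact: phi1.
have eqn (u : n) : sp_n c2 u = formv (Z ** X) (dsubmx u).
  have := geo 0; rewrite -phi0 => /(_ (rng 0) u); rewrite phi0 christoffel_metric.
  rewrite /metric_N c0 c1 !to_identityE !bracket_n0l !scaler0 !subr0 -/c2.
  move/eqP; rewrite subr_eq0 => /eqP ->.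
  rewrite -[u in LHS]vsubmxK bracket_nE sp_nE (sp0r spv) addr0.
  by rewrite (sp_sym spz) bracketE.
have c2E : c2 = col_mx (k^-1 *: (D.1 *m Z) - (k' / k ^+ 2) *: Z)
    (k^-1 *: (D.2 *m X) - (k' / k ^+ 2) *: X).
  have : (k * k) *: c2 = k *: (mx_n D *m col_mx Z X) - k' *: col_mx Z X.
    by rewrite scalemxAr acc [k' *: _ + _]addrC addrK scalerA.
  move/(congr1 (fun v => (k * k)^-1 *: v)); rewrite scalerA mulVf ?mulf_neq0 // scale1r => ->.
  rewrite mx_nE !scale_col_mx opp_col_mx add_col_mx scale_col_mx !scalerBr !scalerA.
  by congr (col_mx (_ *: _ - _ *: _) (_ *: _ - _ *: _)); field.
exists (k^-1 *: D), (- (k' / k ^+ 2)); rewrite scaleNr scaleNr; split.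
- by rewrite -[_ *: _]addr0; apply: in_lieHP Dh _; exact: in_lieH0.
- rewrite -scalemxAl; apply: (sp_inj spz) => Q; have := eqn (col_mx Q 0).
  by rewrite c2E sp_nE col_mxKd (sp0r spv) addr0 (sp0l spz) (sp0r spv).
- rewrite -scalemxAl; apply: (sp_inj spv) => Y; have := eqn (col_mx 0 Y).
  by rewrite c2E sp_nE col_mxKd (sp0r spz) add0r.
Qed.

(** Put [w = (Z, X)], so that [D w = (0, J_Z X)]. The element [(w, D)] of the Lie
    algebra of [G] generates on [n] the affine field [p |-> w + D p + 1/2 [w, p]].
    Its integral curve from the base point, together with the exponential of [D],
    is a one-parameter subgroup, by uniqueness for linear equations. The orbit has
    left-invariant velocity [x t = h t w] and acceleration
    [h t D w = (0, J_(h Z) (h X))], which is the geodesic equation. *)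
Lemma condition_geodesic_orbit :
  (forall Z (X : 'cV_(dimv M)), exists D,
    [/\ @in_lieH R r s M D, D.1 *m Z = 0 & D.2 *m X = Z ** X]) ->
  geodesic_orbit M.
Proof.
move=> H w0; rewrite -[w0]vsubmxK; move: (usubmx w0) (dsubmx w0) => Z X {w0}.
have [D [Dh CZ AX]] := H Z X; have [Csk Ask _] := Dh.
set w : n := col_mx Z X.
have der x y : mx_n D *m br x y = br (mx_n D *m x) y + br x (mx_n D *m y).
  rewrite -[x]vsubmxK -[y]vsubmxK bracket_nE !mx_nE !bracket_nE mulmx0 add_col_mx addr0.
  move: (dsubmx x) (dsubmx y) => X1 Y1; congr col_mx; apply: (sp_inj spz) => Q.
  rewrite Csk (spE spz) !bracketE.
  have := in_lieH_act Q X1 Dh; move=> /(congr1 (fun v => formv v Y1)).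
  by rewrite (spE spv) Ask; lra.
pose N := mx_n D + mx_of (fun x => 2^-1 *: br w x).
have NE x : N *m x = mx_n D *m x + 2^-1 *: br w x.
  rewrite mulmxDl mx_ofE // => a x1 x2.
  by rewrite bracket_nPr scalerDr !scalerA [a * _]mulrC.
(* An affine field is the restriction of a linear one to an affine hyperplane. *)
pose B : 'M[R]_(r + s + dimv M + 1) := block_mx N w 0 0.
pose y t := mexp B t *m col_mx 0 1%:M : 'cV[R]_(r + s + dimv M + 1).
have vy t : vel_at t y (B *m y t) by rewrite mulmxA; exact/vel_at_mulr/vel_at_mexp.
pose p t : n := usubmx (y t).
have y1 t : dsubmx (y t) = 1%:M.
  transitivity (dsubmx (y 0)); last by rewrite /y mexp0 mul1mx col_mxKd.
  apply: (vel_at0_const (f := fun t => dsubmx (y t))) => u.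
  have := vel_at_linear (L := dsubmx) _ (vy u).
  rewrite -[y u]vsubmxK mul_block_col !mul0mx addr0 col_mxKd.
  by apply; exact: linearP.
have vp t : vel_at t p (N *m p t + w).
  have := vel_at_linear (L := usubmx) _ (vy t).
  rewrite -[y t]vsubmxK mul_block_col y1 mulmx1 col_mxKu.
  by apply; exact: linearP.
have p0 : p 0 = 0 by rewrite /p /y mexp0 mul1mx col_mxKu.
pose h t : blocks := (mexp D.1 t, mexp D.2 t).
have vh t : vel_at t (fun u => mx_n (h u)) (mx_n D *m mx_n (h t)).
  rewrite mulmx_block !mulmx0 !mul0mx !addr0 !add0r.
  by apply: vel_at_block; exact: vel_at_mexp.
have vhr t : vel_at t (fun u => mx_n (h u)) (mx_n (h t) *m mx_n D).
  rewrite mulmx_block !mulmx0 !mul0mx !addr0 !add0r.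
  by apply: vel_at_block; exact: vel_at_mexp_r.
have h0 : mx_n (h 0) = 1%:M by rewrite /mx_n /h /= !mexp0 -scalar_mx_block.
have o1 t : orthogonal_mx (@sp_rs R r s) (h t).1 by exact: (orthogonal_flow spz t Csk).
have o2 t : orthogonal_mx (@formv R r s M) (h t).2 by exact: (orthogonal_flow spv t Ask).
have hJ t Q : (h t).2 *m J M Q = J M ((h t).1 *m Q) *m (h t).2.
  apply: (linear_ode_unique (A := D.2) (f := fun t => (h t).2 *m J M Q)
    (g := fun t => J M ((h t).1 *m Q) *m (h t).2)) => [u|u|] /=.
  - by rewrite mulmxA; exact/vel_at_mulr/vel_at_mexp.
  - have vJ : vel_at u (fun t => J M (mexp D.1 t *m Q)) (J M (D.1 *m (mexp D.1 u *m Q))).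
      rewrite mulmxA; apply: vel_at_linear (vel_at_mulr Q (vel_at_mexp _ u)).
      exact: linearP.
    have := vel_at_mul vJ (vel_at_mexp D.2 u); rewrite [J M _ *m (D.2 *m _)]mulmxA -mulmxDl.
    by case: Dh => _ _ /(_ (mexp D.1 u *m Q)) <-; rewrite subrK -mulmxA.
  - by rewrite !mexp0 !mul1mx mulmx1.
have vlaw t u : vel_at t (fun t => mul_N (p t) (mx_n (h t) *m p u))
    (N *m mul_N (p t) (mx_n (h t) *m p u) + w).
  have vq := vel_at_mulr (p u) (vh t); rewrite -mulmxA in vq.
  have := vel_at_mulN (vp t) vq; congr vel_at.
  move: (mx_n (h t) *m p u) (p t) => q x; rewrite !NE /mul_N !(mulmxDr, =^~ scalemxAr) der.
  rewrite !(brE, scaler0, addr0).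
  move: (mx_n D *m x) (mx_n D *m q) => dx dq.
  move: (br dx q) (br x dq) (br w x) (br w q) => a1 a2 a3 a4.
  by apply/colP => i; rewrite !mxE; ring.
have law t u : p (t + u) = mul_N (p t) (mx_n (h t) *m p u).
  apply/eqP; rewrite -subr_eq0; apply/eqP.
  apply: (linear_ode_unique (A := N) (g := fun=> 0)
    (f := fun t => p (t + u) - mul_N (p t) (mx_n (h t) *m p u))) => [{}t|{}t|].
  - have := vel_atD (vel_at_shift (vp (t + u))) (vel_atN (vlaw t u)).
    by rewrite mulmxBr opprD addrACA subrr addr0.
  - by rewrite mulmx0; exact: vel_at_cst.
  - by rewrite add0r p0 h0 mul1mx /mul_N bracket_n0l scaler0 addr0 add0r subrr.
have smp : smooth_on setT p.
  move=> i j k t _; rewrite (_ : (fun u => p u i j) = fun u => y u (lshift 1 i) j).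
    exact: (linear_ode_smooth vy).
  by apply: funext => u; rewrite mxE.
have p'0 : N *m p 0 + w = w by rewrite p0 mulmx0 add0r.
pose x t := mx_n (h t) *m w.
have p'E t : velocity p t = x t + 2^-1 *: br (p t) (x t).
  rewrite (velocityE (vp t)).
  by have := velocity_translate law vp t; rewrite p'0.
have vx t : vel_at t x (mx_n (h t) *m (mx_n D *m w)) by rewrite mulmxA; exact: vel_at_mulr.
have vp' t : vel_at t p (x t + 2^-1 *: br (p t) (x t)).
  by rewrite -p'E (velocityE (vp t)).
have p''E t : velocity (velocity p) t = mx_n (h t) *m (mx_n D *m w)
    + 2^-1 *: br (p t) (mx_n (h t) *m (mx_n D *m w)).
  apply: velocityE.
  have := vel_atD (vx t) (vel_at_mull (2^-1)%:M (vel_at_bracket (vp' t) (vx t))).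
  rewrite !brE !(scaler0, addr0, add0r) mul_scalar_mx.
  by apply: vel_at_ext => u; rewrite mul_scalar_mx -p'E.
have accE t : mx_n (h t) *m (mx_n D *m w) = col_mx 0 (((h t).1 *m Z) ** ((h t).2 *m X)).
  by rewrite !mx_nE CZ AX mulmx0 !mulmxA hJ.
exists p, id, (fun t => (p t, h t)); split.
- by split=> //; split=> [k t|t]; [exact: derivable_derive1n_id|rewrite derive1_id oner_neq0].
- split=> [i j k t _|t _ u]; first exact: smp.
  rewrite christoffel_metric /metric_N p'E p''E !to_identityE !brE.
  rewrite !(scaler0, addr0, subr0, addrK) accE /x mx_nE.
  rewrite -[u]vsubmxK -[p t]vsubmxK !bracket_nE.
  rewrite scale_col_mx scaler0 opp_col_mx add_col_mx oppr0 addr0 !sp_nE.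
  rewrite (sp0l spz) (sp0r spv) add0r addr0 (sp_sym spz ((h t).1 *m Z)) bracketE.
  exact: subrr.
- by split=> //; rewrite p'E p0 bracket_n0l scaler0 addr0 /x h0 mul1mx.
- split=> [||| t | t u] /=; first exact: smp.
  + exact: (linear_ode_smooth (vel_at_mexp D.1)).
  + exact: (linear_ode_smooth (vel_at_mexp D.2)).
  + split=> [||Q]; [exact: o1|exact: o2|].
    by rewrite hJ -mulmxA mulmxV ?mulmx1 // (orthogonal_unit spv (o2 t)).
  + by rewrite law /mul_G /act_G /h /= !mexpD.
- by move=> t; rewrite act_G0.
Qed.

End GeodesicLemma.

(** * The classification *)

Lemma closed_geodesic_orbit (R : realType) (r s : nat) (M : admissible_module R r s) :
  (0 < dimv M)%N -> commutator_closed M -> geodesic_orbit M.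
Proof.
move=> d0 closed; apply: condition_geodesic_orbit => Z X.
exists (adJ closed Z, J M Z); split=> //; first exact: in_lieH_adJ.
exact: closed_self.
Qed.

Theorem theorem2 (R : realType) (r s : nat) (hs : (1 <= s)%N)
    (M : admissible_module R r s) (hM : minimal_admissible M) :
  ((naturally_reductive M <-> (r, s) = (0, 1)%N \/ (r, s) = (1, 2)%N)
   /\ (naturally_reductive M -> geodesic_orbit M))
  /\ (geodesic_orbit M /\ ~ naturally_reductive M <-> (r, s) = (3, 4)%N)
  /\ (~ ((r, s) = (0, 1)%N \/ (r, s) = (1, 2)%N \/ (r, s) = (3, 4)%N) ->
      ~ geodesic_orbit M).
Proof.
have d0 : (0 < dimv M)%N by case: hM.
have nr_sig : naturally_reductive M -> (r, s) = (0, 1)%N \/ (r, s) = (1, 2)%N.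
  by move=> nr; apply: closed_signature d0 hs (naturally_reductive_closed nr).
have sig_nr : (r, s) = (0, 1)%N \/ (r, s) = (1, 2)%N -> naturally_reductive M.
  move=> sig; apply: closed_naturally_reductive d0 _.
  by case: sig => -[r0 s0]; subst r s; [exact: closed_01|exact: closed_12].
have go_sig : geodesic_orbit M ->
    [\/ (r, s) = (0, 1)%N, (r, s) = (1, 2)%N | (r, s) = (3, 4)%N].
  by move=> go; apply: go_signature d0 hs (geodesic_orbit_condition go).
split; first split=> //.
  move=> nr; apply: closed_geodesic_orbit d0 _.
  exact: naturally_reductive_closed.
split; last by move=> out /go_sig[?|?|?]; apply: out; auto.
split=> [[/go_sig[sig|sig|//]]|sig].
- by case; apply: sig_nr; left.
- by case; apply: sig_nr; right.
split; last by move=> /nr_sig; rewrite sig => -[].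
case: sig => r3 s4; subst r s; apply: condition_geodesic_orbit => Z X.
exact: (spin_solvable (minimal34_dim hM)).
Qed.
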